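(* Let $D$ be an integral domain and $\star$ a semistar operation on $D$. If $D$ is a $\widetilde{\star}$-Noetherian domain with $\widetilde{\star}\text{-}\dim(D)=n$, then $\widetilde{\star}\text{-}\dim_v(D)=n$.
   Context: For a domain $D$ with quotient field $K$, $\overline{\mathcal F}(D)$ is the set of nonzero $D$-submodules of $K$ and $f(D)$ the set of nonzero finitely generated $D$-submodules of $K$. A semistar operation on $D$ is a map $\star:\overline{\mathcal F}(D)\to\overline{\mathcal F}(D)$, $E\mapsto E^\star$, such that for all $0\ne x\in K$ and $E,F\in\overline{\mathcal F}(D)$: $(xE)^\star=xE^\star$; $E\subseteq F$ implies $E^\star\subseteq F^\star$; $E\subseteq E^\star=(E^\star)^\star$. Define $E^{\star_f}:=\bigcup\{F^\star\mid F\in f(D),F\subseteq E\}$. A nonzero ideal $I$ of $D$ is a quasi-$\star$-ideal if $I^\star\cap D=I$; a quasi-$\star$-prime is a prime quasi-$\star$-ideal; $\operatorname{QMax}^{\star}(D)$ is the set of maximal elements of the set of proper quasi-$\star$-ideals (they are prime). $\widetilde\star$ is the semistar operation $E^{\widetilde\star}:=\bigcap\{ED_P\mid P\in\operatorname{QMax}^{\star_f}(D)\}$ (equal to $K$ if $\operatorname{QMax}^{\star_f}(D)=\emptyset$). $D$ is $\star$-Noetherian if it satisfies the ascending chain condition on quasi-$\star$-ideals. $\star\text{-}\dim(D)$ is the supremum of the integers $n$ such that there is a chain $(0)\subsetneq P_1\subsetneq\cdots\subsetneq P_n$ with each $P_i$ a quasi-$\star$-prime of $D$; it is $0$ if there are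 no quasi-$\star$-primes. A valuation overring $V$ of $D$, i.e. a valuation domain with $D\subseteq V\subseteq K$ ($V=K$ allowed, of dimension $0$), is a $\star$-valuation overring if $F^\star\subseteq FV$ for each $F\in f(D)$. $\star\text{-}\dim_v(D)=n$ means every $\star$-valuation overring of $D$ has dimension at most $n$ and some $\star$-valuation overring has dimension $n$; if no such integer exists, $\star\text{-}\dim_v(D)=\infty$. *)

(* Defs.v *)
From mathcomp Require Import all_boot all_order all_algebra.
From mathcomp Require Import boolp classical_sets.

Set Implicit Arguments.
Unset Strict Implicit.
Unset Printing Implicit Defensive.

Import Order.TTheory GRing.Theory.

Local Open Scope ring_scope.
Local Open Scope classical_set_scope.

(* A domain is viewed as a subring [A] of its quotient field [K], so that its
   ideals, its submodules of [K] and its overrings are all subsets of [K].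
   The sums in the definitions below may be empty ([n = 0]). *)

Definition submod (K : fieldType) (A E : set K) : Prop :=
  [/\ E 0,
      (forall x y, E x -> E y -> E (x + y)) &
      (forall a x, A a -> E x -> E (a * x))].

Definition nonzero_set (K : fieldType) (E : set K) : Prop :=
  exists2 x, E x & x != 0.

Definition nz_submod (K : fieldType) (A E : set K) : Prop :=
  submod A E /\ nonzero_set E.

Definition span (K : fieldType) (A : set K) (n : nat) (g : 'I_n -> K) : set K :=
  [set x | exists2 c : 'I_n -> K,
      (forall i, A (c i)) & x = \sum_(i < n) c i * g i].

Definition nz_fg_submod (K : fieldType) (A F : set K) : Prop :=
  nonzero_set F /\ exists (n : nat) (g : 'I_n -> K), F = span A g.

Definition scale_set (K : fieldType) (x : K) (E : set K) : set K :=
  [set x * y | y in E].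

Definition mul_set (K : fieldType) (E F : set K) : set K :=
  [set x | exists (n : nat) (e f : 'I_n -> K),
      (forall i, E (e i) /\ F (f i)) /\ x = \sum_(i < n) e i * f i].

Definition ideal (K : fieldType) (A I : set K) : Prop :=
  submod A I /\ I `<=` A.

Definition prime_ideal (K : fieldType) (A P : set K) : Prop :=
  [/\ ideal A P, P <> A &
      forall a b, A a -> A b -> P (a * b) -> P a \/ P b].

Definition localization (K : fieldType) (A P : set K) : set K :=
  [set x | exists a s, [/\ A a, A s, ~ P s & x = a / s]].

(* Only the values of [star] on nonzero [A]-submodules of [K] are meaningful;
   all other values are unconstrained and never used. *)
Definition semistar (K : fieldType) (A : set K) (star : set K -> set K) : Prop :=
  [/\ (forall E, nz_submod A E -> nz_submod A (star E)),
      (forall x E, x != 0 -> nz_submod A E ->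
         star (scale_set x E) = scale_set x (star E)),
      (forall E F, nz_submod A E -> nz_submod A F -> E `<=` F ->
         star E `<=` star F) &
      (forall E, nz_submod A E -> E `<=` star E /\ star (star E) = star E)].

Definition star_f (K : fieldType) (A : set K) (star : set K -> set K)
    (E : set K) : set K :=
  \bigcup_(F in [set F | nz_fg_submod A F /\ F `<=` E]) star F.

Definition quasi_ideal (K : fieldType) (A : set K) (star : set K -> set K)
    (I : set K) : Prop :=
  [/\ ideal A I, nonzero_set I & star I `&` A = I].

Definition quasi_prime (K : fieldType) (A : set K) (star : set K -> set K)
    (P : set K) : Prop :=
  quasi_ideal A star P /\ prime_ideal A P.

Definition qmax (K : fieldType) (A : set K) (star : set K -> set K) :
    set (set K) :=
  [set M | [/\ quasi_ideal A star M, M <> A &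
     forall I, quasi_ideal A star I -> I <> A -> M `<=` I -> I = M]].

Definition star_tilde (K : fieldType) (A : set K) (star : set K -> set K)
    (E : set K) : set K :=
  \bigcap_(P in qmax A (star_f A star)) mul_set E (localization A P).

Definition star_noetherian (K : fieldType) (A : set K)
    (star : set K -> set K) : Prop :=
  forall I : nat -> set K,
    (forall k, quasi_ideal A star (I k)) ->
    (forall k, I k `<=` I k.+1) ->
    exists N, forall k, (N <= k)%N -> I k = I N.

(* Quasi-star-primes are nonzero by definition, so these are the lengths [n] of
   the chains (0) < P_1 < ... < P_n.  The value 0 always belongs to the set. *)
Definition quasi_prime_chain_lengths (K : fieldType) (A : set K)
    (star : set K -> set K) : set nat :=
  [set n | exists P : 'I_n -> set K,
     (forall i, quasi_prime A star (P i)) /\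
     (forall i j : 'I_n, (i < j)%N -> P i `<` P j)].

Definition star_dim (K : fieldType) (A : set K) (star : set K -> set K)
    (n : nat) : Prop :=
  supremums (quasi_prime_chain_lengths A star) n.

Definition krull_dim (K : fieldType) (V : set K) (n : nat) : Prop :=
  supremums [set m | exists P : 'I_m.+1 -> set K,
     (forall i, prime_ideal V (P i)) /\
     (forall i j : 'I_m.+1, (i < j)%N -> P i `<` P j)] n.

(* [V = K] is allowed. *)
Definition valuation_overring (K : fieldType) (A V : set K) : Prop :=
  [/\ subring_closed (mem V), A `<=` V &
      forall x : K, x != 0 -> V x \/ V x^-1].

Definition star_valuation_overring (K : fieldType) (A : set K)
    (star : set K -> set K) (V : set K) : Prop :=
  valuation_overring A V /\
  forall F, nz_fg_submod A F -> star F `<=` mul_set F V.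

Definition star_dimv (K : fieldType) (A : set K) (star : set K -> set K)
    (n : nat) : Prop :=
  (forall V, star_valuation_overring A star V ->
     exists2 m, krull_dim V m & (m <= n)%N) /\
  (exists2 V, star_valuation_overring A star V & krull_dim V n).

Definition domain_in_frac (D : idomainType) : set {fraction D} :=
  range (@FracField.tofrac D).

Arguments domain_in_frac : clear implicits.

(* Main.v *)
(* Every prime chain of a valuation ring over a Noetherian domain [R] is bounded by the
   dimension of [R]: elements of [R] whose values are rationally independent are
   counted prime by prime. If [P < P'] are primes of [R], contractions of primes
   of [V], and [h] is the height of [P' / P], then [R_(P') / P] has [h]
   parameters [z_i] and [R_(P') / (P, z_1^e, .., z_h^e)] has length at most
   [C e^h], whereas the monomials of exponents below [k] in [s] elements
   of [P'] whose values are independent modulo those of [R \ P'] give [k^s] strict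
   steps as soon as [e] is a large multiple of [k]; hence [s <= h].
   A star~-valuation overring [V] other than [K] contains the localization of
   [D] at the center [P] of [V], and [P] lies in some [M] in QMax; then [D_P] is
   Noetherian and its nonzero primes are quasi-star~-primes. Conversely a chain
   of primes [P_1 < .. < P_n] lifts to a valuation ring over [D_(P_n)]. *)
Require Import Defs.
From mathcomp Require Import all_boot all_order all_algebra.
From mathcomp Require Import boolp classical_sets.
From mathcomp Require Import generic_quotient ring zify.

Set Implicit Arguments.
Unset Strict Implicit.
Unset Printing Implicit Defensive.

Import Order.TTheory GRing.Theory.

Local Open Scope ring_scope.
Local Open Scope classical_set_scope.

(** * Subrings of a field: valuation rings, localizations and chains of primes *)

Section SubringsOfAField.
Variable K : fieldType.
Implicit Types (R V W I J P Q E : set K) (x y z : K).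

(** Distinct primes of [V] may contract to the same prime of [R], so chains in [V] cannot be
    compared with chains in [R] directly; rational independence of values can be tested on elements
    of [R].

    No residue ring and no value group is formed. Statements on [R / P] become statements on
    submodules containing [P], and the hypothesis that an element of [P] never has smaller value
    than an element of [R] outside [P] lets the induction climb from [P] to [P'] with [R] and [V]
    unchanged.

    Elements of [R] outside [P'] are units of [R_(P')] but may have positive value in [V], so
    [R_(P')] need not lie in [V]. Hence two valuation rings: [W], the localization of [V] at the
    radical of [c V], dominates [R_(P')] and decides which terms of a relation are negligible, while
    [V] tells the remaining terms apart, modulo a group [G] that absorbs the units of [R_(P')].

    The resulting inequality [k ^ s <= n * (k * L) ^ h] holds for all [k > 0] with [n] and [L]
    fixed, so only the exponents [s] and [h] matter. *)

Definition subring R : Prop :=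
  [/\ R 1, forall x y, R x -> R y -> R (x - y) &
      forall x y, R x -> R y -> R (x * y)].

Lemma subring0 R : subring R -> R 0.
Proof. by case=> R1 RB _; rewrite -(subrr 1); apply: RB. Qed.

Lemma subringN R x : subring R -> R x -> R (- x).
Proof. by move=> sR Rx; case: (sR) => _ RB _; rewrite -sub0r; apply: RB => //; apply: subring0. Qed.

Lemma subringD R x y : subring R -> R x -> R y -> R (x + y).
Proof.
move=> sR Rx Ry; case: (sR) => _ RB _.
by rewrite -(opprK y); apply: RB => //; apply: subringN.
Qed.

Lemma subringM R x y : subring R -> R x -> R y -> R (x * y).
Proof. by case=> _ _; apply. Qed.

Lemma subringX R x n : subring R -> R x -> R (x ^+ n).
Proof.
move=> sR Rx; elim: n => [|n IH]; first by case: sR.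
by rewrite exprS; apply: subringM.
Qed.

Lemma subring_submod R : subring R -> submod R R.
Proof.
move=> sR; split; first exact: subring0.
  by move=> x y; apply: subringD.
by move=> x y; apply: subringM.
Qed.

Lemma submod0 R E : submod R E -> E 0. Proof. by case. Qed.

Lemma submodD R E x y : submod R E -> E x -> E y -> E (x + y).
Proof. by case=> _ + _; apply. Qed.

Lemma submodM R E a x : submod R E -> R a -> E x -> E (a * x).
Proof. by case=> _ _; apply. Qed.

Lemma submodN R E x : subring R -> submod R E -> E x -> E (- x).
Proof.
move=> sR sE Ex; rewrite -mulN1r; apply: (submodM sE) => //.
by apply: subringN => //; case: sR.
Qed.

Lemma submodB R E x y : subring R -> submod R E -> E x -> E y -> E (x - y).
Proof. by move=> sR sE Ex Ey; apply: (submodD sE) => //; apply: (submodN sR sE). Qed.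

Lemma submod_sum R E (T : Type) (s : seq T) (p : pred T) (F : T -> K) :
  submod R E -> (forall i, p i -> E (F i)) -> E (\sum_(i <- s | p i) F i).
Proof.
move=> sE EF; elim/big_rec: _ => [|i x pi Ex]; first exact: submod0 sE.
by apply: (submodD sE) => //; apply: EF.
Qed.

Lemma ideal_eq R I : ideal R I -> I 1 -> I = R.
Proof.
case=> sI IR I1; apply/seteqP; split=> // x Rx.
by rewrite -(mulr1 x); apply: (submodM sI).
Qed.

Lemma prime_ideal1 R P : prime_ideal R P -> ~ P 1.
Proof. by case=> iP PR _ P1; apply: PR; apply: ideal_eq. Qed.

Lemma prime_idealX R P x n : subring R -> prime_ideal R P -> R x -> P (x ^+ n) -> P x.
Proof.
move=> sR pP Rx; elim: n => [/(prime_ideal1 pP)//|n IH].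
case: (pP) => _ _ hP; rewrite exprS => /hP[] //; exact: subringX.
Qed.

Lemma prime_ideal_sub R P x : prime_ideal R P -> P x -> R x.
Proof. by case=> -[_ PR] _ _; apply: PR. Qed.

Lemma prime_ideal0 R P : prime_ideal R P -> P 0.
Proof. by case=> -[[]]. Qed.

Lemma zero_prime R : subring R -> prime_ideal R [set 0].
Proof.
move=> sR; split.
- split=> [|_ ->]; last exact: subring0.
  split=> //= [x y -> ->|a x _ ->]; [exact: addr0|exact: mulr0].
- by move=> R0; case: (sR); rewrite -R0 /= => /eqP; rewrite oner_eq0.
- by move=> a b _ _ /= /eqP; rewrite mulf_eq0 => /orP[]/eqP; [left|right].
Qed.

Definition valring V : Prop := subring V /\ forall x, x != 0 -> V x \/ V x^-1.

Definition unit_set R : set K := [set x | [/\ x != 0, R x & R x^-1]].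

(* [0] is listed apart because [0^-1 = 0] lies in [V]. *)
Definition maxid V : set K := [set x | x = 0 \/ ~ V x^-1].

Lemma valring_total V x y : valring V -> x != 0 -> y != 0 ->
  V (x / y) \/ V (y / x).
Proof.
case=> sV tV x0 y0; case: (tV (x / y)); first by rewrite mulf_neq0 ?invr_eq0.
  by left.
by rewrite invf_div; right.
Qed.

Lemma maxid_sub V x : valring V -> maxid V x -> V x.
Proof.
move=> [sV tV] [->|]; first exact: subring0.
have [->|x0] := eqVneq x 0; first by rewrite invr0 => -[]; apply: subring0.
by case: (tV x x0).
Qed.

Lemma maxid_unit V x : valring V -> maxid V x -> ~ unit_set V x.
Proof. by move=> vV [->|Vx] [x0 _ Vx1] //; move/eqP: x0. Qed.

Lemma unit_set_maxid V x : V x -> ~ maxid V x -> unit_set V x.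
Proof.
move=> Vx nx; split => //; first by apply/eqP => x0; apply: nx; left.
by apply: contrapT => h; apply: nx; right.
Qed.

Lemma maxidM V a x : valring V -> V a -> maxid V x -> maxid V (a * x).
Proof.
move=> [sV tV] Va [->|nx]; first by left; rewrite mulr0.
have [->|a0] := eqVneq a 0; first by left; rewrite mul0r.
right; rewrite invfM => h; apply: nx.
by rewrite -[x^-1](mulVKf a0); apply: subringM.
Qed.

Lemma maxidD V x y : valring V -> maxid V x -> maxid V y -> maxid V (x + y).
Proof.
move=> vV mx my; have [->|x0] := eqVneq x 0; first by rewrite add0r.
have [->|y0] := eqVneq y 0; first by rewrite addr0.
have V1 : V 1 by case: vV => -[].
case: (valring_total vV x0 y0) => h.
  have -> : x + y = (x / y + 1) * y by rewrite mulrDl divfK // mul1r.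
  by apply: maxidM => //; apply: subringD => //; case: vV.
have -> : x + y = (y / x + 1) * x by rewrite mulrDl divfK // mul1r addrC.
by apply: maxidM => //; apply: subringD => //; case: vV.
Qed.

Lemma maxid_submod V : valring V -> submod V (maxid V).
Proof.
move=> vV; split; first by left.
  by move=> x y; apply: maxidD.
by move=> a x; apply: maxidM.
Qed.

Lemma maxid1 V : valring V -> ~ maxid V 1.
Proof. by case=> -[V1 _ _] _ [/eqP|]; rewrite ?oner_eq0 // invr1. Qed.

Lemma maxid_prime V : valring V -> prime_ideal V (maxid V).
Proof.
move=> vV; have sV : subring V by case: vV.
split.
- by split; [exact: maxid_submod|move=> x; apply: maxid_sub].
- by move=> h; apply: (maxid1 vV); rewrite h; case: sV.
- move=> a b Va Vb mab; apply: contrapT => /not_orP[na nb].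
  have [a0 _ Va1] := unit_set_maxid Va na.
  apply: nb; have -> : b = a^-1 * (a * b) by rewrite mulKf.
  exact: maxidM.
Qed.

Lemma maxid_overring V W x : V `<=` W -> maxid W x -> maxid V x.
Proof. by move=> VW [->|nW]; [left|right=> /VW]. Qed.

Lemma valring_root V x n : valring V -> (0 < n)%N -> V (x ^+ n) -> V x.
Proof.
move=> [sV tV]; case: n => // n _ Vx.
have [->|x0] := eqVneq x 0; first exact: subring0.
case: (tV x x0) => // Vx1.
have -> : x = x ^+ n.+1 * x^-1 ^+ n by rewrite exprS exprVn mulfK // expf_neq0.
by apply: subringM => //; apply: subringX.
Qed.

Lemma valring_overring V W : valring V -> subring W -> V `<=` W -> valring W.
Proof. by case=> sV tV sW VW; split=> // x /tV[]/VW; [left|right]. Qed.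

Lemma min_value V (T : eqType) (s : seq T) (t : T -> K) :
  valring V -> s != [::] -> (forall a, a \in s -> t a != 0) ->
  exists2 a, a \in s & forall b, b \in s -> V (t b / t a).
Proof.
move=> vV; have sV : subring V by case: vV.
have V1 : V 1 by case: sV.
elim: s => // a s IH _ t0; have ta : t a != 0 by apply: t0; rewrite mem_head.
have [->|s0] := eqVneq s [::].
  by exists a; rewrite ?mem_head // => b; rewrite inE => /eqP ->; rewrite divff.
have ts0 b : b \in s -> t b != 0 by move=> bs; apply: t0; rewrite inE bs orbT.
have [c cs hc] := IH s0 ts0; have tc := ts0 _ cs.
case: (valring_total vV ta tc) => h.
  exists c; first by rewrite inE cs orbT.
  by move=> b; rewrite inE => /orP[/eqP ->|/hc].
exists a; first exact: mem_head.
move=> b; rewrite inE => /orP[/eqP ->|/hc h2]; first by rewrite divff.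
have -> : t b / t a = (t b / t c) * (t c / t a) by rewrite mulrA divfK.
exact: subringM.
Qed.

(* The value of a sum whose terms have pairwise distinct values is the
   smallest of those values. *)
Lemma sum_distinct_value V W (T : finType) (B : {set T}) (t : T -> K) :
  valring V -> valring W -> V `<=` W -> B != finset.set0 ->
  (forall b, b \in B -> unit_set W (t b)) ->
  (forall b b', b \in B -> b' \in B -> unit_set V (t b / t b') -> b = b') ->
  ~ maxid W (\sum_(b in B) t b).
Proof.
move=> vV vW VW B0 tW tV mS; have sW : subring W by case: vW.
have t0 b : b \in enum B -> t b != 0 by rewrite mem_enum => /tW[].
have eB : enum B != [::] by rewrite -size_eq0 -cardE cards_eq0.
have [a] := min_value vV eB t0.
rewrite mem_enum => aB ha.
have [ta0 Wa Wa1] := tW _ aB.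
pose y := (\sum_(b in B) t b) / t a.
have my : maxid W y by rewrite /y mulrC; apply: maxidM.
have : maxid V (y - 1).
  rewrite /y (bigD1 a) //= mulrDl divff // addrC addKr mulr_suml.
  apply: submod_sum (maxid_submod vV) _ => b /andP[bB ba].
  have Vb : V (t b / t a) by apply: ha; rewrite mem_enum.
  apply: contrapT => /(unit_set_maxid Vb)/tV h.
  by case/eqP: ba; apply: h.
(* [y] is in [maxid W], hence in the larger [maxid V]; so is [y - 1], because every term other than
   [t a] has greater [V]-value than [t a]. *)
move=> my1; apply: (maxid1 vV).
have -> : 1 = y + (- 1) * (y - 1) by ring.
apply: maxidD => //; first exact: maxid_overring my.
apply: maxidM => //; have sV : subring V by case: vV.
by apply: subringN => //; case: sV.
Qed.

Lemma prime_ideal_mul R P s t : prime_ideal R P -> R s -> R t ->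
  ~ P s -> ~ P t -> ~ P (s * t).
Proof. by case=> _ _ h Rs Rt Ps Pt /(h _ _ Rs Rt)[]. Qed.

Lemma notin_prime_neq0 R P s : prime_ideal R P -> ~ P s -> s != 0.
Proof. by move=> pP Ps; apply/eqP => s0; apply: Ps; rewrite s0; apply: prime_ideal0 pP. Qed.

Lemma loc_sub R P : subring R -> prime_ideal R P -> R `<=` localization R P.
Proof.
move=> sR pP x Rx; exists x, 1; split => //; first by case: sR.
  exact: prime_ideal1 pP.
by rewrite divr1.
Qed.

Lemma loc_subring R P : subring R -> prime_ideal R P -> subring (localization R P).
Proof.
move=> sR pP; split.
- by apply: loc_sub => //; case: sR.
- move=> _ _ [a [s [Ra Rs Ps ->]]] [b [t [Rb Rt Pt ->]]].
  have s0 := notin_prime_neq0 pP Ps; have t0 := notin_prime_neq0 pP Pt.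
  exists (a * t - b * s), (s * t); split.
  + by case: (sR) => _ + _; apply; apply: subringM.
  + exact: subringM.
  + exact: (prime_ideal_mul pP).
  + by field; apply/andP.
- move=> _ _ [a [s [Ra Rs Ps ->]]] [b [t [Rb Rt Pt ->]]].
  have s0 := notin_prime_neq0 pP Ps; have t0 := notin_prime_neq0 pP Pt.
  exists (a * b), (s * t); split; [exact: subringM|exact: subringM| |by field; apply/andP].
  exact: (prime_ideal_mul pP).
Qed.

Lemma loc_inv R P s : subring R -> R s -> ~ P s -> localization R P s^-1.
Proof.
by move=> sR Rs Ps; exists 1, s; split=> //; [case: sR|rewrite div1r].
Qed.

(** The extension of [Q] to [R_P]; single fractions suffice because sums have a common denominator.
    For [Q = P] it is the maximal ideal of [R_P]. *)
Definition ext_prime R P Q : set K :=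
  [set x | exists a s, [/\ Q a, R s, ~ P s & x = a / s]].

Lemma loc_ext R P Q : Q `<=` R -> ext_prime R P Q `<=` localization R P.
Proof. by move=> QR x [a [s [/QR Ra Rs Ps ->]]]; exists a, s. Qed.

Lemma ext_prime_in R P Q x : subring R -> prime_ideal R P -> Q x -> ext_prime R P Q x.
Proof.
move=> sR pP Qx; exists x, 1; split=> //; first by case: sR.
  exact: prime_ideal1 pP.
by rewrite divr1.
Qed.

Lemma ext_primeI R P Q : subring R -> prime_ideal R P -> prime_ideal R Q -> Q `<=` P ->
  ext_prime R P Q `&` R = Q.
Proof.
move=> sR pP pQ QP; apply/seteqP; split; last first.
  move=> x Qx; split; first exact: ext_prime_in.
  exact: prime_ideal_sub pQ Qx.
move=> x [[a [s [Qa Rs Ps xE]]] Rx]; have s0 := notin_prime_neq0 pP Ps.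
case: (pQ) => _ _ /(_ x s Rx Rs); rewrite xE divfK // => /(_ Qa)[] // /QP.
by [].
Qed.

Lemma ext_prime_prime R P Q : subring R -> prime_ideal R P -> prime_ideal R Q -> Q `<=` P ->
  prime_ideal (localization R P) (ext_prime R P Q).
Proof.
move=> sR pP pQ QP; have QR x : Q x -> R x by apply: prime_ideal_sub.
have sQ : submod R Q by case: pQ => -[].
have nz s := @notin_prime_neq0 R P s pP.
split.
- split; last exact: loc_ext.
  split; first by apply: ext_prime_in => //; apply: prime_ideal0 pQ.
    move=> _ _ [a [s [Ra Rs Ps ->]]] [b [t [Rb Rt Pt ->]]].
    have s0 := nz _ Ps; have t0 := nz _ Pt.
    exists (t * a + s * b), (s * t); split.
    + by apply: (submodD sQ); apply: (submodM sQ).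
    + exact: subringM.
    + exact: (prime_ideal_mul pP).
    + by field; apply/andP.
  move=> _ _ [a [s [Ra Rs Ps ->]]] [b [t [Rb Rt Pt ->]]].
  have s0 := nz _ Ps; have t0 := nz _ Pt.
  exists (a * b), (s * t); split; [by apply: (submodM sQ) => //; apply: QR|exact: subringM| |by field; apply/andP].
  exact: (prime_ideal_mul pP).
- move=> QL; have R1 : R 1 by case: sR.
  have : (ext_prime R P Q `&` R) 1 by split => //; rewrite QL; apply: loc_sub.
  by rewrite ext_primeI // => /(prime_ideal1 pQ).
- move=> _ _ [a [s [Ra Rs Ps ->]]] [b [t [Rb Rt Pt ->]]] [c [u [Qc Ru Pu e]]].
  have s0 := nz _ Ps; have t0 := nz _ Pt; have u0 := nz _ Pu.
  have : Q (u * (a * b)).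
    have -> : u * (a * b) = (s * t) * c.
      have -> : a * b = s * t * (a / s * (b / t)) by field; apply/andP.
      by rewrite e; field.
    by apply: (submodM sQ) => //; apply: subringM.
  case: (pQ) => _ _ hQ /hQ[]//; [exact: subringM|by move/QP|].
  by move=> /hQ[]// ?; [left; exists a, s|right; exists b, t].
Qed.

Lemma contract_prime R R' Q : subring R -> R `<=` R' -> prime_ideal R' Q ->
  prime_ideal R (Q `&` R).
Proof.
move=> sR RR' pQ; have [[sQ QR'] _ hQ] := pQ; split.
- split=> [|x []//]; split.
  + by split; [exact: submod0 sQ|exact: subring0].
  + by move=> x y [? ?] [? ?]; split; [exact: (submodD sQ)|exact: subringD].
  + by move=> a x ? [? ?]; split; [apply: (submodM sQ) => //; exact: RR'|exact: subringM].
- move=> e; have : (Q `&` R) 1 by rewrite e; case: sR.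
  by case=> /(prime_ideal1 pQ).
- by move=> a b Ra Rb [/hQ h _]; case: h; [exact: RR'|exact: RR'|left|right].
Qed.

Lemma contract_ideal R R' J : subring R -> R `<=` R' -> ideal R' J -> ideal R (J `&` R).
Proof.
move=> sR RR' [sJ _]; split=> [|x []//]; split.
- by split; [exact: submod0 sJ|exact: subring0].
- by move=> x y [? ?] [? ?]; split; [exact: (submodD sJ)|exact: subringD].
- by move=> a x ? [? ?]; split; [apply: (submodM sJ) => //; exact: RR'|exact: subringM].
Qed.

(** Clearing the denominator of an element of [J] lands in the contraction of [J], which therefore
    generates [J]. *)
Lemma loc_contract_sub R P J J' : subring R -> prime_ideal R P ->
  ideal (localization R P) J -> ideal (localization R P) J' ->
  J `&` R `<=` J' `&` R -> J `<=` J'.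
Proof.
move=> sR pP [sJ JL] [sJ' _] h x Jx.
have [a [s [Ra Rs Ps xE]]] := JL _ Jx; have s0 := notin_prime_neq0 pP Ps.
have : (J' `&` R) a.
  apply: h; split=> //; have -> : a = s * x by rewrite xE mulrC divfK.
  by apply: (submodM sJ) => //; apply: loc_sub.
by case=> J'a _; rewrite xE mulrC; apply: (submodM sJ') => //; apply: loc_inv.
Qed.

Lemma loc_contract_inj R P J J' : subring R -> prime_ideal R P ->
  ideal (localization R P) J -> ideal (localization R P) J' ->
  J `&` R = J' `&` R -> J = J'.
Proof.
move=> sR pP iJ iJ' e; apply/seteqP; split.
  by apply: (loc_contract_sub sR pP) => //; rewrite e.
by apply: (loc_contract_sub sR pP) => //; rewrite e.
Qed.

Lemma loc_unit R P x : subring R -> prime_ideal R P -> localization R P x ->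
  ~ ext_prime R P P x -> localization R P x^-1.
Proof.
move=> sR pP [a [s [Ra Rs Ps ->]]] nx; rewrite invf_div.
by exists s, a; split=> // Pa; apply: nx; exists a, s.
Qed.

Lemma loc_prime_sub R P Q : subring R -> prime_ideal R P -> prime_ideal (localization R P) Q ->
  Q `<=` ext_prime R P P.
Proof.
move=> sR pP pQ x Qx; apply: contrapT => nx; have [[sQ QL] _ _] := pQ.
have x1 := loc_unit sR pP (QL _ Qx) nx.
apply: (prime_ideal1 pQ); have x0 : x != 0.
  by apply/eqP => x0; apply: nx; rewrite x0; exact: ext_prime_in (prime_ideal0 pP).
by rewrite -(mulVf x0); apply: (submodM sQ).
Qed.

(** The index counts strict inclusions. Primality is recorded for every member but the first, for
    which lemmas assume it separately. *)
Inductive pchain R P : nat -> set K -> Prop :=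
| pchain0 : pchain R P 0 P
| pchainS k Q Q' : pchain R P k Q -> Q `<=` Q' -> Q <> Q' -> prime_ideal R Q' ->
    pchain R P k.+1 Q'.

Lemma pchain_trans R P k Q l Q' : pchain R P k Q -> pchain R Q l Q' -> pchain R P (l + k) Q'.
Proof.
move=> hP; elim=> [|m A B _ IH AB nAB pB]; first by rewrite add0n.
by rewrite addSn; apply: pchainS IH _ _ _.
Qed.

Lemma pchain_contract R P p k q : subring R -> prime_ideal R P ->
  prime_ideal (localization R P) p ->
  pchain (localization R P) p k q -> pchain R (p `&` R) k (q `&` R).
Proof.
move=> sR pP pp hpq; suff [] : prime_ideal (localization R P) q /\
  pchain R (p `&` R) k (q `&` R) by [].
elim: hpq => [|m A B _ [pA IH] AB nAB pB]; first by split=> //; exact: pchain0.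
split=> //; apply: pchainS IH _ _ _.
- by move=> x [Ax Rx]; split=> //; apply: AB.
- by move=> e; apply: nAB; apply: (loc_contract_inj sR pP) e; [case: pA|case: pB].
- by apply: contract_prime pB => //; apply: loc_sub.
Qed.

End SubringsOfAField.

(** * Noetherian rings: prime products, prime avoidance, systems of parameters *)

Section NoetherianSubrings.
Variable K : fieldType.
Implicit Types (R I J L P Q M E p q : set K) (x y z : K) (ps qs : seq (set K)) (zs : seq K).

Definition noeth R : Prop :=
  forall I : nat -> set K, (forall k, ideal R (I k)) ->
    (forall k, I k `<=` I k.+1) -> exists N, forall k, (N <= k)%N -> I k = I N.

(** Every counterexample has a strictly larger one; iterating a choice of these contradicts the
    chain condition. *)
Lemma noeth_ind R (Phi : set K -> Prop) : noeth R ->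
  (forall I, ideal R I ->
     (forall J, ideal R J -> I `<=` J -> I <> J -> Phi J) -> Phi I) ->
  forall I, ideal R I -> Phi I.
Proof.
move=> nR step I iI; apply: contrapT => nPhi.
have next J : exists J', ideal R J /\ ~ Phi J ->
    [/\ ideal R J', ~ Phi J', J `<=` J' & J <> J'].
  have [[iJ nJ]|n] := pselect (ideal R J /\ ~ Phi J); last by exists J.
  apply: contrapT => nn; apply: nJ; apply: step => // J' iJ' JJ' nJJ'.
  by apply: contrapT => nJ'; apply: nn; exists J'.
have [f fP] := choice next.
have bad k : ideal R (iter k f I) /\ ~ Phi (iter k f I).
  by elim: k => [//|k /fP[]].
have [N /(_ N.+1 (leqnSn N)) e] := nR (fun k => iter k f I) (fun k => proj1 (bad k))
  (fun k => let: And4 _ _ h _ := fP _ (bad k) in h).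
by have [_ _ _ []] := fP _ (bad N).
Qed.

Lemma noeth_loc R P : subring R -> prime_ideal R P -> noeth R -> noeth (localization R P).
Proof.
move=> sR pP nR I iI mI; have [||N hN] := nR (fun k => I k `&` R).
- by move=> k; apply: contract_ideal (iI k) => //; apply: loc_sub.
- by move=> k x [? ?]; split=> //; apply: mI.
- by exists N => k /hN e; apply: (loc_contract_inj sR pP (iI k) (iI N) e).
Qed.

Definition add_gen R I z : set K := [set x | exists i r, [/\ I i, R r & x = i + r * z]].

Definition add_gens R I (zs : seq K) : set K := foldr (fun z J => add_gen R J z) I zs.

Lemma add_gen_sub R I z : subring R -> I `<=` add_gen R I z.
Proof. by move=> sR x Ix; exists x, 0; split=> //; [exact: subring0|rewrite mul0r addr0]. Qed.

Lemma add_gen_mem R I z : subring R -> submod R I -> add_gen R I z z.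
Proof.
move=> sR sI; exists 0, 1; split; [exact: submod0 sI|by case: sR|by rewrite mul1r add0r].
Qed.

Lemma add_gen_submod R I z : subring R -> submod R I -> submod R (add_gen R I z).
Proof.
move=> sR sI; split.
- by apply: add_gen_sub => //; apply: submod0 sI.
- move=> _ _ [i [r [Ii Rr ->]]] [j [t [Ij Rt ->]]]; exists (i + j), (r + t); split.
  + exact: (submodD sI).
  + exact: subringD.
  + by ring.
- move=> a _ Ra [i [r [Ii Rr ->]]]; exists (a * i), (a * r); split.
  + exact: (submodM sI).
  + exact: subringM.
  + by ring.
Qed.

Lemma add_gen_min R I z E : submod R E -> I `<=` E -> E z -> add_gen R I z `<=` E.
Proof.
move=> sE IE Ez _ [i [r [/IE Ei Rr ->]]].
by apply: (submodD sE) => //; apply: (submodM sE).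
Qed.

Lemma add_gen_ideal R I z : subring R -> ideal R I -> R z -> ideal R (add_gen R I z).
Proof.
move=> sR [sI IR] Rz; split; first exact: add_gen_submod.
by apply: add_gen_min => //; apply: subring_submod.
Qed.

Lemma add_gens_submod R I zs : subring R -> submod R I -> submod R (add_gens R I zs).
Proof. by move=> sR sI; elim: zs => //= z zs IH; apply: add_gen_submod. Qed.

Lemma add_gens_sub R I zs : subring R -> I `<=` add_gens R I zs.
Proof.
by move=> sR; elim: zs => //= z zs IH; apply: subset_trans IH _; apply: add_gen_sub.
Qed.

Lemma add_gens_min R I zs E : submod R E -> I `<=` E -> (forall z, z \in zs -> E z) ->
  add_gens R I zs `<=` E.
Proof.
move=> sE IE; elim: zs => //= z zs IH Ezs; apply: add_gen_min => //.
  by apply: IH => y yzs; apply: Ezs; rewrite inE yzs orbT.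
by apply: Ezs; rewrite mem_head.
Qed.

Lemma add_gens_ideal R I zs : subring R -> ideal R I -> (forall z, z \in zs -> R z) ->
  ideal R (add_gens R I zs).
Proof.
move=> sR [sI IR] Rzs; split; first exact: add_gens_submod.
by apply: add_gens_min => //; apply: subring_submod.
Qed.

Lemma add_gens_mem R I zs z : subring R -> submod R I -> z \in zs -> add_gens R I zs z.
Proof.
move=> sR sI; elim: zs => //= y zs IH; rewrite inE => /orP[/eqP ->|/IH].
  by apply: add_gen_mem => //; apply: add_gens_submod.
exact: add_gen_sub.
Qed.

(** Only the products with one factor from each member, not the ideal they generate: for inclusion
    in an ideal this makes no difference. The empty list gives 1. *)
Fixpoint products (ps : seq (set K)) : set K :=
  if ps is p :: ps' then [set x | exists a b, [/\ p a, products ps' b & x = a * b]]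
  else [set 1].

Lemma products_cat ps qs x : products (ps ++ qs) x ->
  exists a b, [/\ products ps a, products qs b & x = a * b].
Proof.
elim: ps x => [|p ps IH] x /=; first by exists 1, x; rewrite mul1r.
move=> [a [b [pa /IH[c [d [pc qd ->]]] ->]]].
by exists (a * c), d; split=> //; [exists a, c|rewrite mulrA].
Qed.

(** Noetherian induction: if [a * b] is in [I] but [a] and [b] are not, then [(I + R a) (I + R b)]
    lies in [I], so the lists found for the two larger ideals can be concatenated. *)
Lemma prime_products R I : subring R -> noeth R -> ideal R I ->
  exists2 ps, (forall p, p \in ps -> prime_ideal R p /\ I `<=` p) & products ps `<=` I.
Proof.
move=> sR nR; move: I; apply: (noeth_ind nR) => I iI IH; have [sI IR] := iI.
have [pI|npI] := pselect (prime_ideal R I).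
  exists [:: I]; first by move=> p; rewrite inE => /eqP ->; split.
  by move=> _ [a [_ [Ia -> ->]]]; rewrite mulr1.
have [eIR|nIR] := pselect (I = R).
  by exists [::] => // _ ->; rewrite eIR; case: sR.
have [a [b [Ra Rb Iab nIa nIb]]] : exists a b, [/\ R a, R b, I (a * b), ~ I a & ~ I b].
  apply: contrapT => n; apply: npI; split=> // a b Ra Rb Iab.
  by apply: contrapT => /not_orP[? ?]; apply: n; exists a, b.
have aux z : R z -> ~ I z -> exists2 ps, (forall p, p \in ps -> prime_ideal R p /\ I `<=` p) &
    products ps `<=` add_gen R I z.
  move=> Rz nIz; have [||e|ps ps1 ps2] := IH (add_gen R I z).
  - exact: add_gen_ideal.
  - exact: add_gen_sub.
  - by apply: nIz; rewrite e; apply: add_gen_mem.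
  exists ps => // p /ps1[pp zp]; split=> //; apply: subset_trans zp; exact: add_gen_sub.
have [ps ps1 ps2] := aux a Ra nIa; have [qs qs1 qs2] := aux b Rb nIb.
exists (ps ++ qs); first by move=> p; rewrite mem_cat => /orP[/ps1|/qs1].
move=> _ /products_cat[_ [_ [/ps2[i [r [Ii Rr ->]]] /qs2[j [t [Ij Rt ->]]] ->]]].
have -> : (i + r * a) * (j + t * b) = (j + t * b) * i + ((r * a) * j + (r * t) * (a * b)) by ring.
apply: (submodD sI); last apply: (submodD sI); apply: (submodM sI) => //; last 2 first.
- exact: subringM.
- exact: subringM.
by apply: subringD; [|exact: IR|exact: subringM].
Qed.

Lemma products_sub R ps : subring R -> (forall p, p \in ps -> p `<=` R) ->
  products ps `<=` R.
Proof.
move=> sR; elim: ps => [|p ps IH] pR x /=; first by move=> ->; case: sR.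
move=> [a [b [pa hb ->]]]; apply: subringM => //.
  by apply: (pR p) => //; rewrite mem_head.
by apply: IH hb => q qs; apply: pR; rewrite inE qs orbT.
Qed.

(** Together with [prime_products] this replaces the finiteness of the set of minimal primes: every
    prime above [I] contains a member of one fixed list. *)
Lemma prime_factor_sub R Q ps : subring R -> prime_ideal R Q ->
  (forall p, p \in ps -> p `<=` R) -> products ps `<=` Q ->
  exists2 p, p \in ps & p `<=` Q.
Proof.
move=> sR pQ; elim: ps => [|p ps IH] pR hQ; first by have /(prime_ideal1 pQ) := hQ 1 erefl.
have pR' q : q \in ps -> q `<=` R by move=> qs; apply: pR; rewrite inE qs orbT.
have [pQ'|npQ] := pselect (p `<=` Q); first by exists p; rewrite ?mem_head.
have [a [pa nQa]] : exists a, p a /\ ~ Q a.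
  by apply: contrapT => n; apply: npQ => a pa; apply: contrapT => nQa; apply: n; exists a.
have [|q qs qQ] := IH pR'; last by exists q; rewrite // inE qs orbT.
move=> b hb; case: (pQ) => _ _ /(_ a b); case=> //.
- by apply: (pR p) => //; rewrite mem_head.
- exact: (products_sub sR pR').
- by apply: hQ; exists a, b.
Qed.

Lemma notsub_ex P Q : ~ (P `<=` Q) -> exists2 x, P x & ~ Q x.
Proof.
move=> n; apply: contrapT => h; apply: n => x Px.
by apply: contrapT => nQx; apply: h; exists x.
Qed.

Lemma prime_meet_avoid R M p ps : subring R -> submod R M -> M `<=` R -> prime_ideal R p ->
  ~ (M `<=` p) -> (forall q, q \in ps -> prime_ideal R q /\ ~ (q `<=` p)) ->
  exists y, [/\ M y, forall q, q \in ps -> q y & ~ p y].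
Proof.
move=> sR sM MR pp /notsub_ex[m Mm npm]; elim: ps => [|q ps IH] hps; first by exists m.
have [|y [My yps npy]] := IH; first by move=> r rs; apply: hps; rewrite inE rs orbT.
have [pq /notsub_ex[z qz npz]] : prime_ideal R q /\ ~ (q `<=` p).
  by apply: hps; rewrite mem_head.
have Rz := prime_ideal_sub pq qz; have Ry := MR _ My.
exists (z * y); split; first exact: (submodM sM).
- move=> r; rewrite inE => /orP[/eqP ->|rs].
    by case: pq => -[sq _] _ _; rewrite mulrC; apply: (submodM sq).
  have [pr _] : prime_ideal R r /\ ~ (r `<=` p) by apply: hps; rewrite inE rs orbT.
  by case: pr => -[sr _] _ _; apply: (submodM sr) => //; apply: yps.
- exact: (prime_ideal_mul pp).
Qed.

Lemma prime_avoidance R M ps : subring R -> submod R M -> M `<=` R ->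
  (forall p, p \in ps -> prime_ideal R p /\ ~ (M `<=` p)) ->
  exists2 w, M w & forall p, p \in ps -> ~ p w.
Proof.
move=> sR sM MR; have [n] := ubnP (size ps); elim: n ps => // n IH [|p ps].
  by exists 0 => //; apply: submod0 sM.
rewrite /= ltnS => szn hps.
have [pp Mp] : prime_ideal R p /\ ~ (M `<=` p) by apply: hps; rewrite mem_head.
have hps' q : q \in ps -> prime_ideal R q /\ ~ (M `<=` q).
  by move=> qs; apply: hps; rewrite inE qs orbT.
have [[q [qs qp]]|nq] := pselect (exists q, q \in ps /\ q `<=` p).
  have := perm_to_rem qs => eps.
  have [||w Mw hw] := IH (p :: rem q ps).
  - by rewrite /= size_rem //; case: (ps) qs szn.
  - move=> r; rewrite inE => /orP[/eqP ->//|rs]; apply: hps'.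
    by rewrite (perm_mem eps) inE rs orbT.
  exists w => // r; rewrite inE => /orP[/eqP ->|]; first by apply: hw; rewrite mem_head.
  rewrite (perm_mem eps) inE => /orP[/eqP -> /qp|rs]; first by apply: hw; rewrite mem_head.
  by apply: hw; rewrite inE rs orbT.
have [||w Mw hw] := IH ps => //.
have [pw|npw] := pselect (p w); last first.
  by exists w => // r; rewrite inE => /orP[/eqP ->|/hw].
have [|y [My yps npy]] := prime_meet_avoid (ps := ps) sR sM MR pp Mp.
  move=> q qs; have [pq _] := hps' _ qs; split=> // qp; apply: nq; by exists q.
exists (w + y); first exact: (submodD sM).
move=> r; rewrite inE => /orP[/eqP ->|rs] h.
  apply: npy; have -> : y = (w + y) - w by ring.
  by case: pp => -[sp _] _ _; apply: (submodB sR sp).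
have [[[sr _] _ _] _] := hps' _ rs; apply: (hw r rs).
have -> : w = (w + y) - y by ring.
by apply: (submodB sR sr) => //; apply: yps.
Qed.

(** A system of parameters of the local ring [R / P]. Each new element avoids every member other
    than [M] of a prime product inside the ideal generated so far; a prime containing it, if not
    [M], is then strictly above a prime already reached by a long chain. *)
Lemma parameters R P M h : subring R -> noeth R -> prime_ideal R P -> prime_ideal R M ->
  (forall Q, prime_ideal R Q -> Q `<=` M) -> (forall k, pchain R P k M -> (k <= h)%N) ->
  exists zs, [/\ size zs = h, forall z, z \in zs -> M z &
    forall Q, prime_ideal R Q -> P `<=` Q -> (forall z, z \in zs -> Q z) -> Q = M].
Proof.
move=> sR nR pP pM locM hch.
have [iP _ _] := pP; have [iM _ _] := pM; have [[sP PR] [sM MR]] := (iP, iM).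
(* The form fit for induction on [h]: a prime above the first [h] parameters is [M] or ends a chain
   of at least [h] steps. In the latter case a further step to [M] would exceed the bound on
   chains. *)
suff [zs [szs zM hzs]] : exists zs, [/\ size zs = h, forall z, z \in zs -> M z &
    forall Q, prime_ideal R Q -> P `<=` Q -> (forall z, z \in zs -> Q z) ->
      (exists2 k, (h <= k)%N & pchain R P k Q) \/ Q = M].
  exists zs; split=> // Q pQ PQ zQ; have [[k hk ch]|//] := hzs Q pQ PQ zQ.
  apply: contrapT => nQM; have /hch : pchain R P k.+1 M.
    by apply: pchainS ch _ nQM pM; exact: locM.
  by rewrite leqNgt ltnS hk.
elim: h {hch} => [|h [zs [szs zM hzs]]].
  exists [::]; split=> // Q pQ PQ _; left.
  have [->|nPQ] := pselect (Q = P); first by exists 0%N => //; exact: pchain0.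
  by exists 1%N => //; apply: pchainS (pchain0 R P) PQ _ pQ => e; apply: nPQ.
have iI : ideal R (add_gens R P zs) by apply: add_gens_ideal => // z /zM /MR.
have [ps hps psI] := prime_products sR nR iI.
have [|w Mw hw] := @prime_avoidance R M [seq p <- ps | `[< p <> M >]] sR sM MR.
  move=> p; rewrite mem_filter => /andP[/asboolP npM /hps[pp _]]; split=> // Mp.
  by apply: npM; apply/seteqP; split=> //; apply: locM.
exists (w :: zs); split; first by rewrite /= szs.
  by move=> z; rewrite inE => /orP[/eqP ->|/zM].
move=> Q pQ PQ zQ.
have zQ' z : z \in zs -> Q z by move=> zs'; apply: zQ; rewrite inE zs' orbT.
have [[sQ QR] _ _] := pQ.
have [||p pps pQ'] := @prime_factor_sub R Q ps sR pQ.
- by move=> p /hps[pp _] x; apply: prime_ideal_sub.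
- apply: subset_trans psI _; exact: add_gens_min.
have [pp zp] := hps _ pps.
have [pM'|npM] := pselect (p = M).
  by right; apply/seteqP; split; [exact: locM|rewrite -pM'].
have [||[k hk ch]|//] := hzs p pp.
- by apply: subset_trans zp; apply: add_gens_sub.
- by move=> z zzs; apply: zp; apply: add_gens_mem.
left; exists k.+1 => //; apply: pchainS ch pQ' _ pQ => e.
apply: (hw p); first by rewrite mem_filter pps andbT; apply/asboolP.
by rewrite e; apply: zQ; rewrite mem_head.
Qed.

End NoetherianSubrings.

(** * Length of quotients of submodules *)

Section Length.
Variable K : fieldType.
Implicit Types (R I J L P Q M E : set K) (x y z : K) (zs : seq K).

(* Every ascending chain of submodules between [I] and [J] has at most [n]
   strict steps, i.e. [J / I] has length at most [n]. *)
Definition length_le R n I J : Prop :=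
  forall k (E : nat -> set K), (forall i, submod R (E i)) ->
    (forall i, I `<=` E i) -> (forall i, E i `<=` J) ->
    (forall i, E i `<=` E i.+1) -> (\sum_(i < k) `[< E i <> E i.+1 >] <= n)%N.

Lemma length_le_mono R n m I I' J J' : (n <= m)%N -> I `<=` I' -> J' `<=` J ->
  length_le R n I J -> length_le R m I' J'.
Proof.
move=> nm II' JJ' h k E sE IE EJ mE; apply: leq_trans nm; apply: h => // i.
  exact: subset_trans (IE i).
exact: subset_trans JJ'.
Qed.

Lemma length_le_refl R J : length_le R 0 J J.
Proof.
move=> k E sE IE EJ mE; rewrite big1 // => i _.
have e j : E j = J by apply/seteqP.
by rewrite !e; case: asboolP.
Qed.

Definition sum_mod I J : set K := [set x | exists i j, [/\ I i, J j & x = i + j]].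

Lemma sum_mod_submod R I J : submod R I -> submod R J -> submod R (sum_mod I J).
Proof.
move=> sI sJ; split.
- by exists 0, 0; split; [exact: submod0 sI|exact: submod0 sJ|rewrite addr0].
- move=> _ _ [i [j [Ii Jj ->]]] [i' [j' [Ii' Jj' ->]]]; exists (i + i'), (j + j').
  by split; [exact: (submodD sI)|exact: (submodD sJ)|rewrite addrACA].
- move=> a _ Ra [i [j [Ii Jj ->]]]; exists (a * i), (a * j).
  by split; [exact: (submodM sI)|exact: (submodM sJ)|rewrite mulrDr].
Qed.

Lemma setI_submod R I J : submod R I -> submod R J -> submod R (I `&` J).
Proof.
move=> sI sJ; split.
- by split; [exact: submod0 sI|exact: submod0 sJ].
- by move=> x y [? ?] [? ?]; split; [exact: (submodD sI)|exact: (submodD sJ)].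
- by move=> a x ? [? ?]; split; [exact: (submodM sI)|exact: (submodM sJ)].
Qed.

(** Modular law: if neither the intersection with [J] nor the sum with [J] changes at a step, the
    step is not strict. So each strict step is charged to one of the two derived chains. *)
Lemma length_le_trans R n m I J L : subring R -> submod R J -> I `<=` J -> J `<=` L ->
  submod R L -> length_le R n I J -> length_le R m J L -> length_le R (n + m) I L.
Proof.
move=> sR sJ IJ JL sL h1 h2 k E sE IE EL mE.
have := h1 k (fun i => E i `&` J); have := h2 k (fun i => sum_mod (E i) J).
move=> /(_ _ _ _ _)H2 /(_ _ _ _ _)H1.
have {}H1 : (\sum_(i < k) `[< E i `&` J <> E i.+1 `&` J >] <= n)%N.
  apply: H1 => i; first exact: setI_submod.
  - by move=> x Ix; split; [exact: IE|exact: IJ].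
  - by move=> x [].
  - by move=> x [? ?]; split=> //; apply: mE.
have {}H2 : (\sum_(i < k) `[< sum_mod (E i) J <> sum_mod (E i.+1) J >] <= m)%N.
  apply: H2 => i; first exact: sum_mod_submod.
  - by move=> x Jx; exists 0, x; split=> //; [exact: submod0 (sE i)|rewrite add0r].
  - by move=> _ [a [b [/EL La /JL Lb ->]]]; apply: (submodD sL).
  - by move=> _ [a [b [Ea Jb ->]]]; exists a, b; split=> //; apply: mE.
apply: leq_trans (leq_add H1 H2); rewrite -big_split; apply: leq_sum => i _ /=.
have [e1|//] := pselect (E i `&` J = E i.+1 `&` J); last first.
  by move=> n1; rewrite (asboolT n1); case: asboolP.
have [e2|n2] := pselect (sum_mod (E i) J = sum_mod (E i.+1) J); last first.
  by rewrite (asboolT n2) addn1; case: asboolP.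
suff -> : E i = E i.+1 by case: asboolP.
apply/seteqP; split; first exact: mE.
move=> x Ex; have : sum_mod (E i.+1) J x.
  by exists x, 0; split=> //; [exact: submod0 sJ|rewrite addr0].
rewrite -e2 => -[a [b [Ea Jb xE]]].
have : (E i.+1 `&` J) b.
  split=> //; have -> : b = x - a by rewrite xE addrC addKr.
  by apply: (submodB sR (sE _)) => //; apply: mE.
by rewrite -e1 => -[Eb _]; rewrite xE; apply: (submodD (sE i)).
Qed.

(** Multiplication by [w] maps [R / I] onto [(J + R w) / J]; chains are pulled back along it. *)
Lemma length_le_mul R n I J w : subring R -> submod R J -> I `<=` R ->
  (forall x, I x -> J (w * x)) ->
  length_le R n I R -> length_le R n J (add_gen R J w).
Proof.
move=> sR sJ IR IJ h k E sE JE EL mE.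
pose F i := [set x | R x /\ E i (w * x)].
apply: leq_trans (h k F _ _ _ _).
- apply: leq_sum => i _; case: asboolP => // nE; rewrite asboolT // => eF; apply: nE.
  apply/seteqP; split; first exact: mE.
  move=> x Ex; have [j [r [Jj Rr xE]]] := EL _ _ Ex.
  have : F i.+1 r.
    split=> //; have -> : w * r = x - j by rewrite xE mulrC addrC addKr.
    by apply: (submodB sR (sE _)) => //; apply: JE.
  rewrite -eF => -[_ Er]; rewrite xE mulrC; apply: (submodD (sE i)) => //; exact: JE.
- move=> i; split.
  + by split; [exact: subring0|rewrite mulr0; exact: submod0 (sE i)].
  + move=> x y [Rx Ex] [Ry Ey]; split; first exact: subringD.
    by rewrite mulrDr; apply: (submodD (sE i)).
  + move=> a x Ra [Rx Ex]; split; first exact: subringM.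
    by rewrite mulrCA; apply: (submodM (sE i)).
- by move=> i x Ix; split; [exact: IR|apply: JE; apply: IJ].
- by move=> i x [].
- by move=> i x [Rx Ex]; split=> //; apply: mE.
Qed.

Lemma length_le_maximal R M : subring R -> (forall x, R x -> ~ M x -> x != 0 /\ R x^-1) ->
  length_le R 1 M R.
Proof.
move=> sR hM k E sE ME ER mE.
have full i x : E i x -> ~ M x -> E i = R.
  move=> Ex nMx; have [x0 Rx1] := hM x (ER _ _ Ex) nMx.
  by apply: ideal_eq => //; rewrite -(mulVf x0); apply: (submodM (sE i)).
(* The bound 1 is sharpened so that the induction also knows that no strict step has occurred while
   [E k] differs from [R]. *)
suff : (\sum_(i < k) `[< E i <> E i.+1 >] <= `[< E k = R >])%N.
  by move=> /leq_trans; apply; case: asboolP.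
elim: k => [|k IH]; first by rewrite big_ord0.
rewrite big_ord_recr /=; move: IH; case: (asboolP (E k = R)) => [ekR|nkR] IH.
  have -> : E k.+1 = R by apply/seteqP; split; [exact: ER|rewrite -ekR; exact: mE].
  by rewrite ekR [X in (_ + X)%N](_ : _ = 0%N) ?addn0; [apply: leq_trans IH _; case: asboolP|case: asboolP].
rewrite leqn0 in IH; rewrite (eqP IH) add0n.
case: asboolP => // nE; rewrite asboolT //.
have [x Ex nEx] : exists2 x, E k.+1 x & ~ E k x.
  by apply: notsub_ex => h; apply: nE; apply/seteqP; split=> //; apply: mE.
by apply: (full _ x) => // /(ME k).
Qed.

(** Some [g] outside [I] satisfies [g M <= I]: otherwise 1 could be multiplied by [N] elements of
    [M] without entering [I]. Then [(I + R g) / I] has length at most 1, and Noetherian induction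
    handles [I + R g]. *)
Lemma finite_length R M I N : subring R -> noeth R -> ideal R M -> ideal R I ->
  (forall x, R x -> ~ M x -> x != 0 /\ R x^-1) -> products (nseq N M) `<=` I ->
  exists n, length_le R n I R.
Proof.
move=> sR nR [sM MR] iI hM; move: I iI; apply: (noeth_ind nR) => I iI IH MI.
have [sI IR] := iI.
have [eIR|nIR] := pselect (I = R); first by exists 0%N; rewrite eIR; exact: length_le_refl.
have [g [Rg nIg hg]] : exists g, [/\ R g, ~ I g & forall x, M x -> I (g * x)].
  apply: contrapT => nex.
  have step g : R g -> ~ I g -> exists2 x, M x & ~ I (x * g).
    move=> Rg nIg; apply: contrapT => n; apply: nex; exists g; split=> // x Mx.
    by apply: contrapT => nI; apply: n; exists x; rewrite // mulrC.
  have : forall n, exists2 x, products (nseq n M) x & ~ I x.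
    elim=> [|n [x Mx nIx]].
      by exists 1 => // I1; apply: nIR; apply: ideal_eq.
    have [|y My nI] := step x _ nIx.
      by apply: (products_sub sR) Mx => p /nseqP[-> _].
    by exists (y * x) => //; exists y, x.
  by case/(_ N) => x /MI.
have [||||n hn] := IH (add_gen R I g).
- exact: add_gen_ideal.
- exact: add_gen_sub.
- by move=> e; apply: nIg; rewrite e; apply: add_gen_mem.
- by apply: subset_trans MI _; apply: add_gen_sub.
exists (1 + n)%N; apply: length_le_trans hn => //.
- exact: add_gen_submod.
- exact: add_gen_sub.
- by case: (add_gen_ideal sR iI Rg).
- exact: subring_submod.
- apply: length_le_mul (length_le_maximal sR hM) => //.
Qed.

(** Filtration by powers of [z]: with [J = I + R z^(e+1)], the quotient [(J + R z^e) / J] is an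
    image of [R / (I + R z)] under multiplication by [z^e]. *)
Lemma length_le_pow R n I z e : subring R -> ideal R I -> R z ->
  length_le R n (add_gen R I z) R -> length_le R (n * e) (add_gen R I (z ^+ e)) R.
Proof.
move=> sR iI Rz h; have [sI IR] := iI.
elim: e => [|e IH].
  have -> : add_gen R I (z ^+ 0) = R; last by rewrite muln0; exact: length_le_refl.
  apply: ideal_eq; last exact: add_gen_mem.
  by apply: add_gen_ideal => //; case: sR.
have Rze := subringX e sR Rz; have Rze1 := subringX e.+1 sR Rz.
set J := add_gen R I (z ^+ e.+1); have iJ : ideal R J by apply: add_gen_ideal.
have [sJ JR] := iJ; have IJ : I `<=` J by apply: add_gen_sub.
rewrite mulnS; apply: (@length_le_trans _ _ _ _ (add_gen R J (z ^+ e))) => //.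
- exact: add_gen_submod.
- exact: add_gen_sub.
- by case: (add_gen_ideal sR iJ Rze).
- exact: subring_submod.
- apply: length_le_mul h => //; first by case: (add_gen_ideal sR iI Rz).
  move=> _ [i [r [Ii Rr ->]]]; rewrite mulrDr; apply: (submodD sJ).
    by apply: (submodM sJ) => //; apply: IJ.
  have -> : z ^+ e * (r * z) = r * z ^+ e.+1 by rewrite exprS; ring.
  by apply: (submodM sJ) => //; apply: add_gen_mem.
- apply: length_le_mono IH => //; apply: add_gen_min => //; first exact: add_gen_submod.
    by apply: subset_trans IJ _; apply: add_gen_sub.
  exact: add_gen_mem.
Qed.

Lemma add_gens_add_gen R I z zs : add_gens R (add_gen R I z) zs = add_gen R (add_gens R I zs) z.
Proof.
have sw J y : add_gen R (add_gen R J y) z `<=` add_gen R (add_gen R J z) y.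
  move=> _ [_ [s [[i [r [Ii Rr ->]]] Rs ->]]]; exists (i + s * z), r; split=> //.
    by exists i, s.
  by ring.
have sw' J y : add_gen R (add_gen R J z) y `<=` add_gen R (add_gen R J y) z.
  move=> _ [_ [s [[i [r [Ii Rr ->]]] Rs ->]]]; exists (i + s * y), r; split=> //.
    by exists i, s.
  by ring.
by elim: zs => //= y zs ->; apply/seteqP; split.
Qed.

(** One generator at a time, the other ones being counted in [I]. This is the only part of
    Hilbert-Samuel theory required: growth of degree at most the number of generators. *)
Lemma length_le_pows R n I zs e : subring R -> ideal R I -> (forall z, z \in zs -> R z) ->
  length_le R n (add_gens R I zs) R ->
  length_le R (n * e ^ size zs) (add_gens R I [seq z ^+ e | z <- zs]) R.
Proof.
move=> sR; elim: zs n I => [|z zs IH] n I iI Rzs h; first by rewrite muln1.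
have Rz : R z by apply: Rzs; rewrite mem_head.
have Rzs' y : y \in zs -> R y by move=> ys; apply: Rzs; rewrite inE ys orbT.
rewrite /= expnS mulnA -add_gens_add_gen; apply: IH => //.
  by apply: add_gen_ideal => //; apply: subringX.
rewrite add_gens_add_gen; apply: length_le_pow => //.
exact: add_gens_ideal.
Qed.

(** A chain below [J'] is prolonged by [L], which makes one more strict step. *)
Lemma length_le_last R n J J' L : J `<=` J' -> submod R J' -> submod R L -> J' `<=` L ->
  J' <> L -> length_le R n J L -> exists2 m, n = m.+1 & length_le R m J J'.
Proof.
move=> JJ' sJ' sL J'L nJL h.
have key k (E : nat -> set K) : (forall i, submod R (E i)) ->
    (forall i, J `<=` E i) -> (forall i, E i `<=` J') -> (forall i, E i `<=` E i.+1) ->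
    (\sum_(i < k) `[< E i <> E i.+1 >] < n)%N.
  move=> sE JE EJ mE.
  pose F i := if (i <= k)%N then E i else L.
  have : (\sum_(i < k.+1) `[< F i <> F i.+1 >] <= n)%N.
    apply: h => i; rewrite /F.
    - by case: ifP.
    - by case: ifP => // _; apply: subset_trans JJ' J'L.
    - case: ifP => _; [exact: (subset_trans (EJ i) J'L)|exact: subset_refl].
    - case: (leqP i k) => ik; last by have -> : (i < k)%N = false by lia.
      case: ifP => _; [exact: mE|exact: (subset_trans (EJ i) J'L)].
  suff -> : (\sum_(i < k.+1) `[< F i <> F i.+1 >] =
      (\sum_(i < k) `[< E i <> E i.+1 >]).+1)%N by [].
  rewrite big_ord_recr /= -[RHS]addn1; congr (_ + _)%N.
    apply: eq_bigr => i _; rewrite /F ltn_ord.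
    by rewrite (ltnW (ltn_ord i)).
  rewrite asboolT // /F leqnn ltnn => e.
  by apply: nJL; apply/seteqP; split=> //; rewrite -e; apply: EJ.
have n0 : (0 < n)%N.
  have := key 0%N (fun=> J') (fun=> sJ') (fun=> JJ') (fun=> @subset_refl _ _) (fun=> @subset_refl _ _).
  by rewrite big_ord0.
exists n.-1; first by rewrite prednK.
by move=> k E *; rewrite -ltnS prednK //; apply: key.
Qed.

Definition span_over R J (T : finType) (t : T -> K) (X : {set T}) : set K :=
  [set x | exists j (r : T -> K), [/\ J j, forall a, R (r a) & x = j + \sum_(a in X) r a * t a]].

Lemma span_over_submod R J (T : finType) (t : T -> K) X : subring R -> submod R J ->
  submod R (span_over R J t X).
Proof.
move=> sR sJ; split.
- exists 0, (fun=> 0); split=> [|a|]; [exact: submod0 sJ|exact: subring0|].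
  by rewrite big1 ?addr0 // => a _; rewrite mul0r.
- move=> _ _ [j [r [Jj Rr ->]]] [j' [r' [Jj' Rr' ->]]].
  exists (j + j'), (fun a => r a + r' a); split=> [|a|].
  + exact: (submodD sJ).
  + exact: subringD.
  + by rewrite addrACA -big_split; congr (_ + _); apply: eq_bigr => a _; rewrite mulrDl.
- move=> c _ Rc [j [r [Jj Rr ->]]]; exists (c * j), (fun a => c * r a); split=> [|a|].
  + exact: (submodM sJ).
  + exact: subringM.
  + by rewrite mulrDr mulr_sumr; congr (_ + _); apply: eq_bigr => a _; rewrite mulrA.
Qed.

(** Removing an element that the others do not generate over [J] makes the span strictly smaller and
    so uses up one unit of length. Which element to remove depends on those left, hence the
    hypothesis on all subsets [Y]. *)
Lemma card_le_length R n J L (T : finType) (t : T -> K) (X : {set T}) :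
  subring R -> submod R J -> submod R L -> J `<=` L -> (forall a, a \in X -> L (t a)) ->
  length_le R n J L ->
  (forall Y : {set T}, Y \subset X -> Y != finset.set0 ->
     exists2 a, a \in Y & ~ span_over R J t (Y :\ a) (t a)) ->
  (#|X| <= n)%N.
Proof.
move=> sR sJ; have [m] := ubnP #|X|; elim: m X n L => // m IH X n L.
rewrite ltnS => cX sL JL XL h hX.
have [->|X0] := eqVneq X finset.set0; first by rewrite cards0.
have [a aX na] := hX X (subxx _) X0.
have XaL b : b \in X :\ a -> L (t b) by rewrite finset.inE => /andP[_ /XL].
set J' := span_over R J t (X :\ a) in na.
have [||||m' -> h'] := @length_le_last R n J J' L _ _ sL _ _ h.
- move=> x Jx; exists x, (fun=> 0); split=> //; first by move=> _; exact: subring0.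
  by rewrite big1 ?addr0 // => b _; rewrite mul0r.
- exact: span_over_submod.
- move=> _ [j [r [Jj Rr ->]]]; apply: (submodD sL); first exact: JL.
  by apply: (submod_sum _ sL) => b bX; apply: (submodM sL) => //; apply: XaL.
- by move=> e; apply: na; rewrite e; apply: XL.
rewrite (cardsD1 a X) aX add1n ltnS; apply: IH h' _ => //.
- by move: cX; rewrite (cardsD1 a X) aX.
- exact: span_over_submod.
- move=> x Jx; exists x, (fun=> 0); split=> //; first by move=> _; exact: subring0.
  by rewrite big1 ?addr0 // => b _; rewrite mul0r.
- move=> b bX; exists 0, (fun c => if c == b then 1 else 0); split.
  + exact: submod0 sJ.
  + by move=> c; case: ifP => _; [case: sR|exact: subring0].
  + rewrite add0r (bigD1 b) //= eqxx mul1r big1 ?addr0 // => c /andP[_ /negbTE ->].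
    by rewrite mul0r.
- by move=> Y YX; apply: hX; apply: (fintype.subset_trans YX); exact: finset.subsetDl.
Qed.

End Length.

(** * Counting elements by values, and rational independence of values *)

Section Values.
Variable K : fieldType.
Implicit Types (R V W J G H : set K) (x y z : K) (xs ys : seq K).

(* A relation among the [t a] modulo [J] would force two terms of least
   [W]-value to have the same [V]-value up to a unit of [R]. *)
Lemma card_le_colength V W R J n (T : finType) (t : T -> K) :
  valring V -> valring W -> V `<=` W -> subring R -> R `<=` W ->
  (forall r, R r -> ~ maxid W r -> R r^-1) -> ideal R J ->
  (forall a, R (t a)) -> (forall a, t a != 0) ->
  (forall a j, J j -> maxid W (j / t a)) ->
  (forall a b u, unit_set R u -> unit_set V (u * t a / t b) -> a = b) ->
  length_le R n J R -> (#|T| <= n)%N.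
Proof.
move=> vV vW VW sR RW uR [sJ JR] Rt t0 Jt dist hn; rewrite -cardsT.
have sW : subring W by case: vW.
apply: (card_le_length (t := t) sR sJ (subring_submod sR) JR _ hn) => // Y _ Y0.
have eY : enum Y != [::] by rewrite -size_eq0 -cardE cards_eq0.
have [a] := min_value vW eY (fun b _ => t0 b).
rewrite mem_enum => aY ha; exists a => // -[j [r [Jj Rr ta]]].
(* The relation [t a = j + ...] with all monomials on one side: coefficient -1 at [a], total
   [- j]. *)
pose r' b := if b == a then -1 else r b.
have Rr' b : R (r' b).
  by rewrite /r'; case: ifP => // _; apply: subringN => //; case: sR.
(* The terms of least [W]-value. After division by [t a], all other terms and [j] lie in [maxid W],
   so the sum over [B] does too, against [sum_distinct_value]. *)
pose B := [set b in Y | `[< unit_set R (r' b) /\ unit_set W (t b / t a) >]]%SET.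
have aB : a \in B.
  rewrite finset.inE aY /=; apply/asboolP; rewrite /r' eqxx divff //.
  have [R1 _ _] := sR; have [W1 _ _] := sW; split; split; rewrite ?invrN ?invr1 ?oppr_eq0 ?oner_eq0 //.
    exact: subringN.
  exact: subringN.
have WtY b : b \in Y -> W (t b / t a) by move=> bY; apply: ha; rewrite mem_enum.
have uR' b : R (r' b) -> ~ maxid W (r' b) -> unit_set R (r' b).
  move=> Rb nm; split=> //; last exact: uR.
  by apply/eqP => e; apply: nm; left.
apply: (@sum_distinct_value K V W T B (fun b => r' b * t b / t a)) => //.
- by apply/set0Pn; exists a.
- move=> b; rewrite finset.inE => /andP[_ /asboolP[[r0 Rb Rb1] [tb0 Wb Wb1]]].
  split; first by rewrite -mulrA mulf_neq0.
    by rewrite -mulrA; apply: subringM => //; apply: RW.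
  by rewrite -mulrA invfM; apply: subringM => //; apply: RW.
- move=> b b'; rewrite !finset.inE => /andP[_ /asboolP[[r0 Rb Rb1] _]].
  move=> /andP[_ /asboolP[[r0' Rb' Rb1'] _]] h.
  apply: (dist b b' (r' b / r' b')).
    split; first by rewrite mulf_neq0 ?invr_eq0.
      exact: subringM.
    by rewrite invf_div; apply: subringM.
  suff <- : r' b * t b / t a / (r' b' * t b' / t a) = r' b / r' b' * t b / t b' by [].
  have := t0 a; have := t0 b'; move=> *; field; rewrite r0'; do ?[apply/andP; split=> //].
- have sM := maxid_submod vW.
  have e : \sum_(b in Y) r' b * t b / t a = - (j / t a).
    rewrite (bigD1 a) //= {1}/r' eqxx mulN1r mulNr divff //.
    rewrite (eq_bigr (fun b => r b * t b / t a)); last first.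
      by move=> b /andP[_ /negbTE ba]; rewrite /r' ba.
    rewrite -mulr_suml.
    have -> : \sum_(i in Y | i != a) r i * t i = t a - j.
      rewrite ta addrC addKr; apply: eq_bigl => b.
      by rewrite !finset.inE andbC.
    by rewrite mulrBl divff // addKr.
  have BY : B \subset Y by apply/fintype.subsetP => b; rewrite finset.inE => /andP[].
  move: e; rewrite (big_setID B) /= (finset.setIidPr BY) => e.
  have -> : \sum_(b in B) r' b * t b / t a =
      - (j / t a) - \sum_(b in Y :\: B) r' b * t b / t a by rewrite -e addrK.
  have m1 : maxid W (j / t a) by apply: Jt.
  apply: (submodB sW sM); first exact: (submodN sW sM).
  apply: (submod_sum _ sM) => b; rewrite !finset.inE => /andP[nB bY].
  rewrite bY /= in nB; move/asboolP: nB => nB.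
  rewrite -mulrA; have [m|nm] := pselect (maxid W (r' b)).
    by rewrite mulrC; apply: maxidM => //; apply: WtY.
  apply: maxidM => //; first exact: RW.
  apply: contrapT => nm'; apply: nB; split; first exact: uR'.
  by apply: unit_set_maxid => //; apply: WtY.
Qed.

(* [G] is a subgroup of the multiplicative group of [K] with torsion-free
   quotient. *)
Definition radical_group G : Prop :=
  [/\ G 1 /\ (forall x, G x -> x != 0), forall x y, G x -> G y -> G (x * y),
      forall x, G x -> G x^-1 &
      forall x n, x != 0 -> (0 < n)%N -> G (x ^+ n) -> G x].

Lemma unit_set_radical V : valring V -> radical_group (unit_set V).
Proof.
move=> vV; have [sV tV] := vV; split.
- split; last by move=> x [].
  by case: sV => V1 _ _; split; rewrite ?invr1 ?oner_neq0.
- move=> x y [x0 Vx Vx1] [y0 Vy Vy1]; split; first exact: mulf_neq0.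
    exact: subringM.
  by rewrite invfM; apply: subringM.
- by move=> x [x0 Vx Vx1]; split; rewrite ?invr_eq0 ?invrK.
- move=> x n x0 n0 [_ Vx Vx1]; split=> //; first exact: valring_root Vx.
  by apply: (valring_root vV n0); rewrite exprVn.
Qed.

Lemma radicalX G x n : radical_group G -> G x -> G (x ^+ n).
Proof.
by move=> [[G1 _] GM _ _] Gx; elim: n => // n IH; rewrite exprS; apply: GM.
Qed.

Lemma radicalXz G x (e : int) : radical_group G -> G x -> G (x ^ e).
Proof.
move=> rG Gx; case: e => n; first exact: radicalX.
by rewrite NegzE -invr_expz; case: (rG) => _ _ GV _; apply: GV; apply: radicalX.
Qed.

Lemma radical_rootz G x (e : int) : radical_group G -> x != 0 -> e != 0 -> G (x ^ e) -> G x.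
Proof.
move=> [_ _ GV Gr] x0; case: e => n e0 Gx.
  by apply: Gr Gx; rewrite // lt0n.
by apply: (Gr _ n.+1) => //; move/GV: Gx; rewrite NegzE -invr_expz invrK.
Qed.

(** The elements with a positive power in the group generated by [G] and [y]. It plays the part of
    the rational span of [G] and [y], so that linear algebra over the rationals is done inside
    [K]. *)
Definition adjoin G y : set K :=
  [set x | x != 0 /\ exists n (e : int), (0 < n)%N /\ G (x ^+ n * y ^ e)].

Lemma adjoin_sub G y : G 1 -> (forall x, G x -> x != 0) -> G `<=` adjoin G y.
Proof.
by move=> G1 G0 x Gx; split; [exact: G0|exists 1%N, 0; rewrite expr0z mulr1 expr1].
Qed.

Lemma adjoin_mem G y : radical_group G -> y != 0 -> adjoin G y y.
Proof.
move=> [[G1 _] _ _ _] y0; split=> //; exists 1%N, (-1); split=> //.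
by rewrite expr1 -invr_expz expr1z divff.
Qed.

Lemma adjoin_min G H y : radical_group H -> G `<=` H -> H y -> adjoin G y `<=` H.
Proof.
move=> rH GH Hy x [x0 [n [e [n0 /GH Hx]]]]; have [[_ H0] HM HV Hr] := rH.
apply: (Hr _ n) => //; have := HM _ _ Hx (radicalXz (- e) rH Hy).
by rewrite -mulrA -expfzDr ?(H0 y) // subrr expr0z mulr1.
Qed.

Lemma adjoin_radical G y : radical_group G -> y != 0 -> radical_group (adjoin G y).
Proof.
move=> rG y0; have [[G1 G0] GM GV Gr] := rG; split.
- by split; [apply: adjoin_sub|move=> x []].
- move=> x x' [x0 [n [e [n0 h]]]] [x'0 [n' [e' [n'0 h']]]].
  split; first exact: mulf_neq0.
  exists (n * n')%N, (e * n' + e' * n); split; first by rewrite muln_gt0 n0.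
  have := GM _ _ (radicalX n' rG h) (radicalX n rG h').
  rewrite !exprMn -!exprM [(y ^ e) ^+ _]exprnP [(y ^ e') ^+ _]exprnP !exprz_exp [(n' * n)%N]mulnC.
  by rewrite expfzDr // mulrACA.
- move=> x [x0 [n [e [n0 h]]]]; split; first by rewrite invr_eq0.
  exists n, (- e); split=> //.
  by move/GV: h; rewrite invfM invr_expz -exprVn.
- move=> x n x0 n0 [_ [m [e [m0 h]]]]; split=> //; exists (n * m)%N, e.
  by rewrite muln_gt0 n0 exprM.
Qed.

(** Steinitz exchange: the exponent of [y] in the relation is nonzero, as otherwise [x] would be a
    root of an element of [G]. Hence the relation also expresses [y] by [x], after inversion if the
    exponent is negative. *)
Lemma adjoin_exchange G x y : radical_group G -> x != 0 -> y != 0 ->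
  adjoin G y x -> ~ G x -> adjoin G x y.
Proof.
move=> rG x0 y0 [_ [n [e [n0 h]]]] nGx; have [[G1 G0] GM GV Gr] := rG.
have e0 : e != 0.
  by apply/eqP => e0; apply: nGx; apply: Gr n0 _ => //; rewrite e0 expr0z mulr1 in h.
split=> //; case: e e0 h => m m0 h.
  by exists m, n; rewrite lt0n; split=> //; rewrite mulrC.
exists m.+1, (- n%:Z); split=> //; move/GV: h.
by rewrite invfM NegzE invr_expz opprK mulrC -invr_expz.
Qed.

Definition value_span G ys : set K := foldr (fun y H => adjoin H y) G ys.

Fixpoint indep G xs : Prop :=
  if xs is x :: xs' then ~ value_span G xs' x /\ indep G xs' else True.

Lemma span_radical G ys : radical_group G -> (forall y, y \in ys -> y != 0) ->
  radical_group (value_span G ys).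
Proof.
move=> rG; elim: ys => //= y ys IH ys0; apply: adjoin_radical.
  by apply: IH => z zs; apply: ys0; rewrite inE zs orbT.
by apply: ys0; rewrite mem_head.
Qed.

Lemma span_sub G ys : radical_group G -> (forall y, y \in ys -> y != 0) ->
  G `<=` value_span G ys.
Proof.
move=> rG; elim: ys => [|y ys IH] ys0 /=; first exact: subset_refl.
have ys0' z : z \in ys -> z != 0 by move=> zs; apply: ys0; rewrite inE zs orbT.
have [[h1 h0] _ _ _] := span_radical rG ys0'.
by apply: subset_trans (IH ys0') _; apply: adjoin_sub.
Qed.

Lemma span_mem G ys y : radical_group G -> (forall z, z \in ys -> z != 0) ->
  y \in ys -> value_span G ys y.
Proof.
move=> rG; elim: ys => //= z ys IH ys0.
have ys0' w : w \in ys -> w != 0 by move=> ws; apply: ys0; rewrite inE ws orbT.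
have r := span_radical rG ys0'; have [[h1 h0] _ _ _] := r.
rewrite inE => /orP[/eqP ->|yys]; last by apply: adjoin_sub => //; apply: IH.
by apply: adjoin_mem => //; apply: ys0; rewrite mem_head.
Qed.

Lemma span_min G H ys : radical_group H -> G `<=` H -> (forall y, y \in ys -> H y) ->
  value_span G ys `<=` H.
Proof.
move=> rH GH; elim: ys => //= y ys IH hys; apply: adjoin_min => //.
  by apply: IH => z zs; apply: hys; rewrite inE zs orbT.
by apply: hys; rewrite mem_head.
Qed.

(** By exchange, enlarging the base group by one element spoils at most one member of an independent
    list. *)
Lemma indep_adjoin G y xs : radical_group G -> y != 0 ->
  (forall x, x \in xs -> x != 0) -> indep G xs ->
  indep (adjoin G y) xs \/ (value_span G xs y /\ exists xs',
    [/\ size xs = (size xs').+1, {subset xs' <= xs} & indep (adjoin G y) xs']).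
Proof.
move=> rG y0; have rGy := adjoin_radical rG y0; have [[G1 G0] _ _ _] := rG.
have GGy := @adjoin_sub G y G1 G0.
elim: xs => [|x xs IH] xs0 /=; first by left.
have xs0' z : z \in xs -> z != 0 by move=> zs; apply: xs0; rewrite inE zs orbT.
have x0 : x != 0 by apply: xs0; rewrite mem_head.
have rs := span_radical rG xs0'; have [[s1 s0] _ _ _] := rs.
move=> [nx ixs]; have [i1|[sy [xs' [sz sub i1]]]] := IH xs0' ixs; last first.
  right; split; first exact: adjoin_sub.
  exists (x :: xs'); split; first by rewrite /= sz.
    by move=> z; rewrite !inE => /orP[->//|/sub ->]; rewrite orbT.
  split=> // h; apply: nx; apply: (span_min rs _ _ h).
    exact: (adjoin_min rs (span_sub rG xs0') sy).
  by move=> z /sub; apply: span_mem.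
have [h|nh] := pselect (value_span (adjoin G y) xs x); last by left.
right; split; last by exists xs; split=> // z; rewrite inE orbC => ->.
apply: adjoin_exchange => //.
apply: (span_min (adjoin_radical rs y0) _ _ h).
  apply: adjoin_min (adjoin_radical rs y0) _ (adjoin_mem rs y0).
  by apply: subset_trans (span_sub rG xs0') _; apply: adjoin_sub.
by move=> z zs; apply: adjoin_sub => //; apply: span_mem.
Qed.

(** Induction on [ys]: its head is absorbed into the base group, at the cost of at most one member
    of [xs]. *)
Lemma indep_size G xs ys : radical_group G ->
  (forall x, x \in xs -> x != 0) -> (forall y, y \in ys -> y != 0) ->
  indep G xs -> (forall x, x \in xs -> value_span G ys x) -> (size xs <= size ys)%N.
Proof.
move=> + + + + h; elim: ys G xs h => [|y ys IH] G xs h rG xs0 ys0 ixs.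
  case: xs h xs0 ixs => //= x xs h xs0 [nx _]; case: nx.
  apply: span_sub => //; last by apply: h; rewrite mem_head.
  by move=> z zs; apply: xs0; rewrite inE zs orbT.
have y0 : y != 0 by apply: ys0; rewrite mem_head.
have ys0' z : z \in ys -> z != 0 by move=> zs; apply: ys0; rewrite inE zs orbT.
have rGy := adjoin_radical rG y0; have [[G1 G0] _ _ _] := rG.
have sub : value_span G (y :: ys) `<=` value_span (adjoin G y) ys.
  have r' := span_radical rGy ys0'; apply: span_min => //.
    exact: (subset_trans (@adjoin_sub G y G1 G0) (span_sub rGy ys0')).
  move=> z; rewrite inE => /orP[/eqP ->|]; last exact: span_mem.
  by apply: span_sub => //; apply: adjoin_mem.
have [i1|[_ [xs' [-> sx i1]]]] := indep_adjoin rG y0 xs0 ixs.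
  by rewrite /= leqW // (IH (adjoin G y)) // => x /h /sub.
rewrite /= ltnS (IH (adjoin G y)) // => x /sx; last exact: xs0.
by move=> /h /sub.
Qed.

Lemma indep_exponents G xs (e : nat -> int) : radical_group G ->
  (forall x, x \in xs -> x != 0) -> indep G xs ->
  G (\prod_(i < size xs) nth 0 xs i ^ e i) -> forall i, (i < size xs)%N -> e i = 0.
Proof.
move=> rG; elim: xs e => //= x xs IH e xs0 [nx ixs].
have xs0' z : z \in xs -> z != 0 by move=> zs; apply: xs0; rewrite inE zs orbT.
have x0 : x != 0 by apply: xs0; rewrite mem_head.
have rs := span_radical rG xs0'; have [[_ s0] sM sV _] := rs.
rewrite big_ord_recl /= => Gp.
have sp : value_span G xs (\prod_(i < size xs) nth 0 xs i ^ e i.+1).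
  elim/big_ind: _ => //; first by case: rs => -[].
  by move=> i _; apply: radicalXz => //; apply: span_mem => //; apply: mem_nth.
have e0 : e 0%N = 0.
  apply: contrapT => /eqP ne0; apply: nx; apply: (radical_rootz rs x0 ne0).
  have := sM _ _ (span_sub rG xs0' Gp) (sV _ sp); rewrite mulfK //.
  exact: s0.
rewrite e0 expr0z mul1r in Gp.
case=> // i; rewrite ltnS => ii; exact: (IH (fun i => e i.+1)).
Qed.

End Values.

(** * The rational rank of values against chains of primes of a Noetherian ring *)

Section ValueRank.
Variable K : fieldType.
Implicit Types (R V W J P Q G : set K) (x y z c : K) (xs zs : seq K).

(* The contraction to [R] of the radical of [c V]. *)
Definition center R V c : set K := [set r | R r /\ exists n, V (r ^+ n / c)].

Lemma center_prime R V c : valring V -> subring R -> R `<=` V -> ~ V c^-1 ->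
  prime_ideal R (center R V c).
Proof.
move=> vV sR RV nVc; have [sV tV] := vV.
have c0 : c != 0 by apply/eqP => c0; apply: nVc; rewrite c0 invr0; exact: subring0.
have C0 : center R V c 0.
  by split; [exact: subring0|exists 1%N; rewrite expr1 mul0r; exact: subring0].
have D x y : x != 0 -> y != 0 -> V (x / y) -> center R V c x -> center R V c y ->
    center R V c (x + y).
  move=> x0 y0 Vxy [Rx _] [Ry [n Vn]]; split; first exact: subringD.
  exists n; have -> : x + y = (x / y + 1) * y by rewrite mulrDl divfK // mul1r.
  rewrite exprMn -mulrA; apply: subringM => //; apply: subringX => //.
  by apply: subringD => //; case: sV.
have prim a b : a != 0 -> b != 0 -> R a -> V (a / b) -> center R V c (a * b) ->
    center R V c a.
  (* The exponent doubles: as [b] divides [a] in [V], the product [a * b] divides [a ^+ 2]. *)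
  move=> a0 b0 Ra Vab [_ [n Vn]]; split=> //; exists (n + n)%N.
  have -> : a ^+ (n + n) / c = (a / b) ^+ n * ((a * b) ^+ n / c).
    by rewrite exprD -[a in a ^+ n * _](divfK b0) !exprMn; ring.
  by apply: subringM => //; apply: subringX.
split.
- split; last by move=> x [].
  split=> //.
    move=> x y Cx Cy; have [->|x0] := eqVneq x 0; first by rewrite add0r.
    have [->|y0] := eqVneq y 0; first by rewrite addr0.
    case: (valring_total vV x0 y0) => h; first exact: D.
    by rewrite addrC; apply: D.
  move=> a x Ra [Rx [n Vn]]; split; first exact: subringM.
  by exists n; rewrite exprMn -mulrA; apply: subringM => //; apply: subringX => //; apply: RV.
- move=> e; have [R1 _ _] := sR; move: R1; rewrite -e => -[_ [n]].
  by rewrite expr1n mul1r.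
- move=> a b Ra Rb Cab; have [->|a0] := eqVneq a 0; first by left.
  have [->|b0] := eqVneq b 0; first by right.
  case: (valring_total vV a0 b0) => h; first by left; apply: prim Cab.
  by right; apply: prim h _ => //; rewrite mulrC.
Qed.

Lemma maxid_loc R P x : prime_ideal R P -> P x -> maxid (localization R P) x.
Proof.
move=> pP Px; have [->|x0] := eqVneq x 0; first by left.
right=> -[a [s [Ra Rs Ps e]]]; apply: (Ps); have s0 := notin_prime_neq0 pP Ps.
have -> : s = a * x by apply: (mulIf (invr_neq0 x0)); rewrite mulfK // e mulrC divfK.
by case: pP => -[sP _] _ _; apply: (submodM sP).
Qed.

(** If [s > h], then [k = n L^h + 1] would give [k^(h+1) <= n L^h k^h], that is [k <= n L^h]. *)
Lemma exp_count_bound h s n L : (forall k, (0 < k)%N -> (k ^ s <= n * (k * L) ^ h)%N) ->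
  (s <= h)%N.
Proof.
move=> H; rewrite leqNgt; apply/negP => hs.
have k0 : (0 < (n * L ^ h).+1)%N by [].
have := H _ k0; set k := (n * L ^ h).+1 in k0 *.
have h1 : (k ^ h.+1 <= k ^ s)%N by apply: leq_pexp2l.
move=> /(leq_trans h1); rewrite expnMn mulnCA expnSr leq_pmul2l ?expn_gt0 ?k0 //.
by rewrite /k ltnn.
Qed.

Lemma common_exponent V c zs : subring V -> (forall z, z \in zs -> V z /\ exists n, V (z ^+ n / c)) ->
  exists L, forall z, z \in zs -> V (z ^+ L / c).
Proof.
move=> sV; elim: zs => [|z zs IH] h; first by exists 0%N.
have [|L hL] := IH; first by move=> y ys; apply: h; rewrite inE ys orbT.
have [Vz [n hn]] := h z (mem_head _ _).
exists (n + L)%N => y; rewrite inE => /orP[/eqP ->|ys].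
  by rewrite exprD mulrAC; apply: subringM => //; apply: subringX.
have [Vy _] : V y /\ exists n, V (y ^+ n / c) by apply: h; rewrite inE ys orbT.
by rewrite exprD -mulrA; apply: subringM; [|exact: subringX|exact: hL].
Qed.

(** The count takes place in [R' = R_(P')], where [P R'] and [h] parameters generate an ideal of
    finite colength. [W] dominates [R'], and [G] contains the units of [R'], so monomials with
    independent values modulo [G] stay distinct up to such units. *)
Lemma rank_between R V P c h xs G : subring R -> noeth R -> valring V -> R `<=` V ->
  prime_ideal R P -> (forall p x, P p -> R x -> ~ P x -> V (p / x)) ->
  R c -> ~ P c -> ~ V c^-1 ->
  (forall k, pchain R P k (center R V c) -> (k <= h)%N) ->
  radical_group G -> unit_set V `<=` G ->
  (forall u, R u -> ~ center R V c u -> G u) ->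
  (forall x, x \in xs -> [/\ R x, ~ P x & V (c / x)]) ->
  indep G xs -> (size xs <= h)%N.
Proof.
move=> sR nR vV RV pP cP Rc nPc nVc hch rG VG uG hxs ixs.
have [sV tV] := vV.
set P' := center R V c in hch uG *.
have pP' : prime_ideal R P' by apply: center_prime.
set Q := center V V c; have pQ : prime_ideal V Q by apply: center_prime.
set W := localization V Q; set R' := localization R P'.
have sR' : subring R' by apply: loc_subring.
have sW : subring W by apply: loc_subring.
have VW : V `<=` W by apply: loc_sub.
have RR' : R `<=` R' by apply: loc_sub.
have vW : valring W by apply: valring_overring VW.
have c0 : c != 0 by apply/eqP => c0; apply: nVc; rewrite c0 invr0; exact: subring0.
have R'W : R' `<=` W.
  move=> _ [a [s [Ra Rs nP's ->]]]; exists a, s; split=> //; try exact: RV.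
  by move=> [_ ex]; apply: nP's; split.
have PP' : P `<=` P'.
  move=> p Pp; split; first exact: prime_ideal_sub pP Pp.
  by exists 1%N; rewrite expr1; apply: cP.
have mQ x : Q x -> maxid W x by apply: maxid_loc.
have mP' x : P' x -> maxid W x by move=> [Rx ex]; apply: mQ; split=> //; exact: RV.
have s0 s : ~ P' s -> s != 0 by apply: notin_prime_neq0 pP'.
have mM x : ext_prime R P' P' x -> maxid W x.
  move=> [a [s [P'a Rs nP's ->]]]; rewrite mulrC; apply: maxidM => //.
    by apply: R'W; apply: loc_inv.
  exact: mP'.
have uR' r : R' r -> ~ maxid W r -> R' r^-1.
  by move=> Rr nm; apply: loc_unit => // /mM.
have cs s : R s -> ~ P' s -> V (c / s).
  move=> Rs nP's; case: (valring_total vV c0 (s0 _ nP's)) => // h1.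
  by case: nP's; split=> //; exists 1%N; rewrite expr1.
set PE := ext_prime R P' P; set M := ext_prime R P' P'.
have pPE : prime_ideal R' PE by apply: ext_prime_prime.
have pM : prime_ideal R' M by apply: ext_prime_prime.
have hch' k : pchain R' PE k M -> (k <= h)%N.
  by move=> ch; have := pchain_contract sR pP' pPE ch; rewrite !ext_primeI // => /hch.
have nR' : noeth R' by apply: noeth_loc.
have [zs [szs zM zmax]] := parameters sR' nR' pPE pM (fun Q => loc_prime_sub sR pP') hch'.
have [iPE _ _] := pPE; have [iM _ _] := pM.
have [sPE PER] := iPE; have [sM MR] := iM.
have Rzs z : z \in zs -> R' z by move/zM/MR.
have iI : ideal R' (add_gens R' PE zs) by apply: add_gens_ideal.
have [ps hps psI] := prime_products sR' nR' iI.
have eps : ps = nseq (size ps) M.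
  apply/all_pred1P/allP => p /hps[pp Ip]; apply/eqP; apply: zmax => //.
    by apply: subset_trans Ip; apply: add_gens_sub.
  by move=> z zz; apply: Ip; apply: add_gens_mem.
rewrite eps in psI.
have uM x : R' x -> ~ M x -> x != 0 /\ R' x^-1.
  move=> R'x nMx; split; last exact: loc_unit.
  by apply/eqP => x0; apply: nMx; rewrite x0; exact: prime_ideal0 pM.
have [n hn] := finite_length sR' nR' iM iI uM psI.
have [L hL] : exists L, forall z, z \in zs -> W z /\ V (z ^+ L / c).
  have [|L hL] := @common_exponent V c zs sV; last first.
    by exists L => z zz; split; [exact/R'W/Rzs|exact: hL].
  move=> z /zM[a [s [[Ra [m Vm]] Rs nP's ->]]].
  have nP'sm k : ~ P' (s ^+ k) by move/(prime_idealX sR pP' Rs).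
  (* Doubling the exponent gains a second factor [c], which pays for the denominator: powers of [s]
     stay outside [P'] and therefore divide [c] in [V]. *)
  have ex : V ((a / s) ^+ (m + m) / c).
    have -> : (a / s) ^+ (m + m) / c =
        (a ^+ m / c) * (a ^+ m / c) * (c / s ^+ (m + m)).
      by rewrite !exprMn exprVn [a ^+ (m + m)]exprD; field; rewrite c0 expf_neq0 ?s0.
    apply: subringM => //; first exact: subringM.
    by apply: cs => //; exact: subringX.
  split; last by exists (m + m)%N.
  have [m0|m0] := posnP (m + m)%N.
    by case: nVc; move: ex; rewrite m0 expr0 mul1r.
  apply: (valring_root vV m0); rewrite -[_ ^+ _](divfK c0).
  by apply: subringM => //; apply: RV.
apply: (@exp_count_bound h (size xs) n (L * size xs).+1) => k k0.
pose T := {ffun 'I_(size xs) -> 'I_k}.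
pose t (a : T) := \prod_(i < size xs) nth 0 xs i ^+ a i.
have xsn (i : 'I_(size xs)) : nth 0 xs i \in xs by apply: mem_nth.
have xs0 x : x \in xs -> x != 0 by move/hxs => [_ nPx _]; exact: (notin_prime_neq0 pP nPx).
have t0 a : t a != 0 by apply/prodf_neq0 => i _; apply: expf_neq0; apply: xs0.
have tRP a : R (t a) /\ ~ P (t a).
  rewrite /t; elim/big_ind: _.
  - by split; [case: sR|exact: prime_ideal1 pP].
  - by move=> x y [? ?] [? ?]; split; [exact: subringM|exact: (prime_ideal_mul pP)].
  - move=> i _; have [Rx nPx _] := hxs _ (xsn i); split; first exact: subringX.
    by move/(prime_idealX sR pP Rx).
have -> : (k ^ size xs = #|{: T}|)%N by rewrite card_ffun !card_ord.
(* [e = k * (L * size xs + 1)]: in [V], [c] divides [z ^+ L] and every monomial divides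
   [c ^+ (size xs * k)], so [L * size xs * k] factors [z] cover any monomial. The [k > 0] factors
   left put the quotient into [maxid W]. *)
set e := (k * _)%N.
have h1 := length_le_pows (e := e) sR' iPE Rzs hn; rewrite szs in h1.
have cdiv a : V (c ^+ (size xs * k) / t a).
  have -> : c ^+ (size xs * k) / t a = \prod_(i < size xs) (c ^+ k / nth 0 xs i ^+ a i).
    by rewrite big_split /= prodfV prodr_const card_ord -exprM mulnC.
  elim/big_ind: _ => //; [by case: sV|by move=> x y; apply: subringM|].
  move=> i _; have [_ _ Vcx] := hxs _ (xsn i).
  have -> : c ^+ k / nth 0 xs i ^+ a i = c ^+ (k - a i) * (c / nth 0 xs i) ^+ a i.
    by rewrite exprMn exprVn mulrA -exprD subnK // ltnW.
  by apply: subringM => //; apply: subringX => //; apply: RV.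
apply: (card_le_colength (t := t) vV vW VW sR' R'W uR' _ _ t0 _ _ h1).
- by apply: add_gens_ideal => // _ /mapP[z zz ->]; apply: subringX => //; apply: Rzs.
- by move=> a; apply: RR'; case: (tRP a).
- move=> a; have sE : submod R' [set x | maxid W (x / t a)].
    have sm := maxid_submod vW; split=> /=.
    + by rewrite mul0r; left.
    + by move=> x y ? ?; rewrite mulrDl; apply: maxidD.
    + by move=> b x ? ?; rewrite -mulrA; apply: maxidM => //; apply: R'W.
  apply: (add_gens_min sE).
    move=> _ [p [s [Pp Rs nP's ->]]] /=; rewrite mulrAC mulrC; apply: maxidM => //.
      by apply: R'W; apply: loc_inv.
    have [Rta nPta] := tRP a; apply: mQ; split; first exact: cP.
    exists 1%N; rewrite expr1 -mulrA -invfM; apply: cP => //; first exact: subringM.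
    exact: (prime_ideal_mul pP).
  move=> _ /mapP[z zz ->] /=; have [Wz VzL] := hL _ zz.
  have -> : z ^+ e / t a =
      (z ^+ k.-1 * ((z ^+ L / c) ^+ (size xs * k) * (c ^+ (size xs * k) / t a))) * z.
    have -> : (e = k.-1 + 1 + L * (size xs * k))%N.
      by rewrite addn1 prednK // /e mulnS; congr addn; rewrite mulnC mulnA.
    rewrite !exprD expr1 exprM [in RHS]exprMn exprVn.
    have := expf_neq0 (size xs * k)%N c0; move: (c ^+ _) (_ ^+ _ ^+ _) (t a) (t0 a).
    by move=> y X u u0 y0; field; apply/andP.
  apply: maxidM => //; last exact/mM/zM.
  apply: subringM => //; first exact: subringX.
  by apply: VW; apply: subringM => //; apply: subringX.
- move=> a b u [u0 R'u R'u1] Vu.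
  (* A unit of [R'] is a quotient of two elements of [R] outside [P'], because [P'] lies in
     [maxid W]. *)
  have Gu : G u.
    case: R'u u0 R'u1 Vu => d [s [Rd Rs nP's ->]] u0 R'u1 _.
    have [_ GM GV _] := rG; apply: GM; last by apply: GV; apply: uG.
    apply: uG => // P'd; have : maxid W (d / s) by apply: mM; exists d, s.
    by move/(maxid_unit vW); apply; split=> //; [apply: R'W; exists d, s|exact: R'W].
  (* Exponent differences extended to all of [nat], as [indep_exponents] expects; the default 0
     occurs only out of range. *)
  pose d (i : nat) : int := if insub i is Some j then (a j : nat)%:Z - (b j : nat)%:Z else 0.
  have Gab : G (\prod_(i < size xs) nth 0 xs i ^ d i).
    have -> : \prod_(i < size xs) nth 0 xs i ^ d i = u^-1 * (u * t a / t b).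
      rewrite mulrA mulKf // /t -prodfV -big_split /=; apply: eq_bigr => i _.
      by rewrite /d valK expfzDr ?xs0 // -invr_expz.
    by have [_ GM GV _] := rG; apply: GM; [exact: GV|exact: VG].
  apply/ffunP => i; apply/val_inj.
  have := indep_exponents rG xs0 ixs Gab (ltn_ord i); rewrite /d valK /= => /eqP.
  by rewrite subr_eq0 => /eqP[].
Qed.

Lemma longest_seq (Phi : seq K -> Prop) b : Phi [::] ->
  (forall xs, Phi xs -> (size xs <= b)%N) ->
  exists2 xs, Phi xs & forall ys, Phi ys -> (size ys <= size xs)%N.
Proof.
move=> Phi0 Phib.
pose p n := `[< exists2 xs, Phi xs & size xs = n >].
have ex : exists n, p n by exists 0%N; apply/asboolP; exists [::].
have bd n : p n -> (n <= b)%N by move/asboolP => [xs /Phib h <-].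
case: (ex_maxnP ex bd) => n /asboolP[xs Pxs <-] hmax.
by exists xs => // ys Pys; apply: hmax; apply/asboolP; exists ys.
Qed.

(* Induction on [b]: let [c] have the largest value in [xs] and let [P'] be the
   center of [c]. Elements of [xs] independent modulo the values of [R \ P'] are
   at most as many as the steps of a longest chain from [P] to [P'], and
   independent values of [R \ P'] at most as many as the remaining steps. *)
Theorem value_rank_le R V b P xs : subring R -> noeth R -> valring V -> R `<=` V ->
  prime_ideal R P -> (forall p x, P p -> R x -> ~ P x -> V (p / x)) ->
  (forall k Q, pchain R P k Q -> (k <= b)%N) ->
  (forall x, x \in xs -> R x /\ ~ P x) -> indep (unit_set V) xs ->
  (size xs <= b)%N.
Proof.
move=> sR nR vV RV; have [n] := ubnP b; elim: n b P xs => // n IH b P xs.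
rewrite ltnS => bn pP cP chP hxs ixs; have [sV tV] := vV.
have rU := unit_set_radical vV.
have [->//|xs1] := eqVneq xs [::].
have xs0 x : x \in xs -> x != 0 by move/hxs => [_]; exact: (notin_prime_neq0 pP).
(* Least value among the inverses is greatest value in [xs]. *)
have [|c cxs hc] := @min_value K V K xs (fun x => x^-1) vV xs1.
  by move=> x /xs0; rewrite invr_eq0.
have {}hc x : x \in xs -> V (c / x) by move/hc; rewrite invrK mulrC.
have [Rc nPc] := hxs _ cxs; have c0 := xs0 _ cxs.
have nVc : ~ V c^-1.
  move=> Vc1; have Uc : unit_set V c by split=> //; apply: RV.
  elim: xs {hxs xs1 hc} ixs xs0 cxs => //= x xs IHx [nx ixs] xs0.
  have xs0' y : y \in xs -> y != 0 by move=> ys; apply: xs0; rewrite inE ys orbT.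
  rewrite inE => /orP[/eqP e|cxs]; last exact: IHx.
  by apply: nx; rewrite -e; apply: span_sub.
set P' := center R V c.
have pP' : prime_ideal R P' by apply: center_prime.
have PP' : P `<=` P'.
  move=> p Pp; split; first exact: prime_ideal_sub pP Pp.
  by exists 1%N; rewrite expr1; apply: cP.
have P'c : P' c by split=> //; exists 1%N; rewrite expr1 divff //; case: sV.
have nPP' : P <> P' by move=> e; apply: nPc; rewrite e.
pose pc k := `[< pchain R P k P' >].
have ex : exists k, pc k.
  by exists 1%N; apply/asboolP; apply: pchainS (pchain0 R P) PP' nPP' pP'.
have bd k : pc k -> (k <= b)%N by move/asboolP/chP.
case: (ex_maxnP ex bd) => h /asboolP ch hmax.
(* [P'] is strictly above [P] because it contains [c]; so [b - h < b] and the induction applies at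
   [P']. *)
have h0 : (0 < h)%N.
  by apply: hmax; apply/asboolP; apply: pchainS (pchain0 R P) PP' nPP' pP'.
have hb := chP _ _ ch.
(* The comparison hypothesis passes to [P']: an [x] divisible in [V] by an element of [P'] would
   itself be in the center of [c]. *)
have cP' p x : P' p -> R x -> ~ P' x -> V (p / x).
  move=> [Rp [m Vm]] Rx nP'x; have x0 := notin_prime_neq0 pP' nP'x.
  have [->|p0] := eqVneq p 0; first by rewrite mul0r; exact: subring0.
  case: (valring_total vV p0 x0) => // h1; case: nP'x; split=> //; exists m.
  have -> : x ^+ m / c = (x / p) ^+ m * (p ^+ m / c).
    by rewrite -{1}(divfK p0 x) exprMn mulrA.
  by apply: subringM => //; apply: subringX.
have chP' k Q : pchain R P' k Q -> (k <= b - h)%N.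
  by move=> /(pchain_trans ch)/chP; rewrite leq_subRL // addnC.
have bh : (b - h < n)%N by lia.
have [||hs [hsP ihs] hsmax] :=
    @longest_seq (fun ys => (forall x, x \in ys -> R x /\ ~ P' x) /\ indep (unit_set V) ys) (b - h).
- by [].
- by move=> ys [ysP iys]; apply: (IH _ P').
have hs0 y : y \in hs -> y != 0 by move/hsP => [_]; exact: (notin_prime_neq0 pP').
(* Since [hs] is a longest independent list outside [P'], its span contains all elements of [R]
   outside [P'], as [rank_between] requires of [G]. *)
set G := value_span (unit_set V) hs.
have rG : radical_group G by apply: span_radical.
have UG : unit_set V `<=` G by apply: span_sub.
have P'G u : R u -> ~ P' u -> G u.
  move=> Ru nP'u; apply: contrapT => nGu.
  have := hsmax (u :: hs); rewrite /= ltnn => H; suff : false by [].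
  by apply: H; split=> // x; rewrite inE => /orP[/eqP ->|/hsP].
have [||C [CP iC] Cmax] :=
    @longest_seq (fun ys => (forall x, x \in ys -> x \in xs) /\ indep G ys) h.
- by [].
- move=> ys [ysP iys].
  apply: (rank_between (P := P) (c := c) (G := G) sR nR vV RV) => //.
    by move=> k hk; apply: hmax; apply/asboolP.
  by move=> x /ysP xxs; have [? ?] := hxs _ xxs; split=> //; apply: hc.
have Ch : (size C <= h)%N.
  apply: (rank_between (P := P) (c := c) (G := G) sR nR vV RV) iC => //.
    by move=> k hk; apply: hmax; apply/asboolP.
  by move=> x /CP xxs; have [? ?] := hxs _ xxs; split=> //; apply: hc.
have hsb : (size hs <= b - h)%N by apply: (IH _ P').
have : (size xs <= size (C ++ hs))%N.
  apply: (indep_size rU) => //.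
    by move=> y; rewrite mem_cat => /orP[/CP/xs0|/hs0].
  move=> x xxs; rewrite /value_span foldr_cat -/(value_span _ hs) -/G.
  apply: contrapT => nx; have := Cmax (x :: C); rewrite /= ltnn => H.
  suff : false by [].
  by apply: H; split=> // y; rewrite inE => /orP[/eqP ->|/CP].
by rewrite size_cat; lia.
Qed.

End ValueRank.

(** * Chains of primes in valuation rings: upper bound and existence *)

Section ValuationOverrings.
Variable K : fieldType.
Implicit Types (A B C R V W P Q N E : set K) (x y z : K) (xs ys : seq K).

(** From the top down, take an element in each gap between [Q i] and [Q i.+1]. It is not a unit of
    [V] localized at [Q i.+1], whereas the elements taken earlier are; and the units of a valuation
    ring form a radical group. *)
Lemma chain_indep V (Q : nat -> set K) m : valring V ->
  (forall i, (i <= m)%N -> prime_ideal V (Q i)) ->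
  (forall i, (i < m)%N -> Q i `<=` Q i.+1) ->
  (forall i, (i < m)%N -> ~ (Q i.+1 `<=` Q i)) ->
  exists ys, [/\ size ys = m, indep (unit_set V) ys & forall y, y \in ys -> y != 0].
Proof.
move=> vV pQ QS nQ; have [sV tV] := vV.
suff H j : (j <= m)%N -> exists ys, [/\ size ys = j, indep (unit_set V) ys &
    forall y, y \in ys -> V y /\ ~ Q (m - j)%N y].
  have [ys [sz iys hys]] := H m (leqnn m); exists ys; split=> // y /hys[_].
  by apply: (@notin_prime_neq0 _ V); apply: pQ; apply: leq_subr.
elim: j => [_|j IH jm]; first by exists [::].
have [ys [sz iys hys]] := IH (ltnW jm).
have e : (m - j)%N = (m - j.+1).+1 by rewrite subnSK.
have lt : (m - j.+1 < m)%N by lia.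
have [y Qy nQy] := notsub_ex (nQ _ lt); rewrite -e in Qy.
have pj : prime_ideal V (Q (m - j)%N) by apply: pQ; apply: leq_subr.
exists (y :: ys); split; first by rewrite /= sz.
  split=> // sy; have sW := loc_subring sV pj.
  have VW := loc_sub sV pj; have vW := valring_overring vV sW VW.
  apply: (maxid_unit vW (maxid_loc pj Qy)).
  apply: (span_min (unit_set_radical vW) _ _ sy).
    by move=> x [x0 Vx Vx1]; split=> //; apply: VW.
  move=> x /hys[Vx nQx]; split; [exact: notin_prime_neq0 pj nQx|exact: VW|].
  exact: loc_inv.
move=> z; rewrite inE => /orP[/eqP ->|/hys[Vz nQz]].
  by split=> //; apply: prime_ideal_sub pj Qy.
by split=> // h; apply: nQz; rewrite e; apply: QS.
Qed.

(** [K] consists of quotients of elements of [R], so a longest independent list in [R] spans all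
    values rationally and is at least as long as the list from [chain_indep]. It is bounded by
    [value_rank_le] with [P = 0]. *)
Theorem valuation_chain_le R V (Q : nat -> set K) m b : subring R -> noeth R ->
  (forall x, exists a s, [/\ R a, R s, s != 0 & x = a / s]) ->
  (forall k P, pchain R [set 0] k P -> (k <= b)%N) ->
  valring V -> R `<=` V ->
  (forall i, (i <= m)%N -> prime_ideal V (Q i)) ->
  (forall i, (i < m)%N -> Q i `<=` Q i.+1) ->
  (forall i, (i < m)%N -> ~ (Q i.+1 `<=` Q i)) -> (m <= b)%N.
Proof.
move=> sR nR fR chR vV RV pQ QS nQ; have [sV _] := vV.
have rU := unit_set_radical vV.
have [ys [<- iys ys0]] := chain_indep vV pQ QS nQ.
pose Phi xs := (forall x, x \in xs -> R x /\ ~ [set 0] x) /\ indep (unit_set V) xs.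
have Phib xs : Phi xs -> (size xs <= b)%N.
  case=> hxs ixs; apply: (value_rank_le sR nR vV RV (zero_prime sR) _ chR hxs ixs).
  by move=> _ x -> _ _; rewrite mul0r; apply: subring0.
have [|xs [hxs ixs] xsmax] := @longest_seq _ Phi b _ Phib; first by [].
have xs0 x : x \in xs -> x != 0 by move=> /hxs[_ nx]; apply/eqP.
apply: leq_trans (Phib xs _) => //; apply: (indep_size rU) => //.
have rs := span_radical rU xs0.
have inspan a : R a -> a != 0 -> value_span (unit_set V) xs a.
  move=> Ra a0; apply: contrapT => na.
  have H := xsmax (a :: xs); suff : (size (a :: xs) <= size xs)%N by rewrite ltnn.
  by apply: H; split=> // x; rewrite inE => /orP[/eqP ->|/hxs //]; split=> //=; apply/eqP.
move=> y /ys0 y0; have [a [s [Ra Rs s0 ye]]] := fR y.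
have a0 : a != 0 by apply: contra_neq y0 => a0; rewrite ye a0 mul0r.
have [_ sM sI _] := rs; rewrite ye; apply: sM; first exact: inspan.
by apply: sI; apply: inspan.
Qed.

(** The [C]-submodule generated by [N], given by its derivations: induction on these traces an
    element over the union of a chain of rings to one member of the chain. *)
Inductive ideal_gen N C : K -> Prop :=
| ideal_gen0 : ideal_gen N C 0
| ideal_gen_mem x : N x -> ideal_gen N C x
| ideal_genD x y : ideal_gen N C x -> ideal_gen N C y -> ideal_gen N C (x + y)
| ideal_genM c x : C c -> ideal_gen N C x -> ideal_gen N C (c * x).

Lemma ideal_gen_submod N C : submod C (ideal_gen N C).
Proof. by split; [constructor|apply: ideal_genD|apply: ideal_genM]. Qed.

Lemma ideal_gen_min N C E : submod C E -> N `<=` E -> ideal_gen N C `<=` E.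
Proof.
move=> sE NE x; elim=> [|y /NE//|y z _ Ey _ Ez|c y Cc _ Ey]; first exact: submod0 sE.
  exact: (submodD sE).
exact: (submodM sE).
Qed.

Definition poly_ext C x : set K := [set y | exists2 p : {poly K}, forall i, C p`_i & y = p.[x]].

Lemma poly_ext_subring C x : subring C -> subring (poly_ext C x).
Proof.
move=> sC; split.
- by exists 1; rewrite ?hornerE // => i; rewrite coef1; case: (i == 0)%N; [case: sC|exact: subring0].
- move=> _ _ [p Cp ->] [q Cq ->]; exists (p - q); last by rewrite !hornerE.
  by move=> i; rewrite coefB; case: (sC) => _ + _; apply.
- move=> _ _ [p Cp ->] [q Cq ->]; exists (p * q); last by rewrite hornerM.
  move=> i; rewrite coefM; apply: (submod_sum _ (subring_submod sC)) => j _.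
  exact: subringM.
Qed.

Lemma poly_ext_sub C x : subring C -> C `<=` poly_ext C x.
Proof.
move=> sC y Cy; exists y%:P; last by rewrite hornerC.
by move=> i; rewrite coefC; case: ifP => _ //; apply: subring0.
Qed.

Lemma poly_ext_mem C x : subring C -> poly_ext C x x.
Proof.
move=> sC; exists 'X; last by rewrite hornerX.
by move=> i; rewrite coefX; case: eqP => _; [case: sC|exact: subring0].
Qed.

Lemma ideal_gen_poly N C x y : ideal_gen N (poly_ext C x) y ->
  exists2 p : {poly K}, forall i, ideal_gen N C p`_i & y = p.[x].
Proof.
have sg := ideal_gen_submod N C.
elim=> [|z Nz|z t _ [p hp ->] _ [q hq ->]|c z [q Cq ->] _ [p hp ->]].
- by exists 0; rewrite ?horner0 // => i; rewrite coef0; constructor.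
- exists z%:P; last by rewrite hornerC.
  by move=> i; rewrite coefC; case: ifP => _; [apply: ideal_gen_mem|constructor].
- by exists (p + q); rewrite ?hornerD // => i; rewrite coefD; apply: ideal_genD.
- exists (q * p); last by rewrite hornerM.
  by move=> i; rewrite coefM; apply: (submod_sum _ sg) => j _; apply: ideal_genM.
Qed.

(* A relation of minimal degree for [x] is shortened by means of the one for
   [x^-1]. *)
Lemma no_double_relation C E x m l (a b : nat -> K) : subring C -> submod C E ->
  E `<=` C -> ~ E 1 -> x != 0 -> (forall i, E (a i)) -> (forall i, E (b i)) ->
  \sum_(i < m) a i * x ^+ i = 1 -> \sum_(i < l) b i * x^-1 ^+ i <> 1.
Proof.
move=> sC sE EC nE1.
have [n] := ubnP (m + l)%N; elim: n m l x a b => // n IH m l x a b.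
rewrite ltnS => mln x0 Ea Eb.
wlog lm : m l x a b mln x0 Ea Eb / (l <= m)%N => [H|].
  case: (leqP l m) => [|/ltnW] lm; first exact: H.
  move=> ha hb; have x1 : x^-1 != 0 by rewrite invr_eq0.
  apply: (H l m x^-1 b a _ x1 Eb Ea lm hb); first by rewrite addnC.
  by rewrite invrK.
case: m lm mln => [|[|m]] lm mln; first by rewrite big_ord0 => /esym/eqP; rewrite oner_eq0.
  by rewrite big_ord1 expr0 mulr1 => a1; case: nE1; rewrite -a1.
move=> ha hb.
pose b' i := if (i < l)%N then b i else 0.
have Eb' i : E (b' i) by rewrite /b'; case: ifP => _ //; apply: submod0 sE.
have hb' : \sum_(i < m.+2) b' i * x^-1 ^+ i = 1.
  rewrite -hb (big_ord_widen _ (fun i => b i * x^-1 ^+ i) lm) [RHS]big_mkcond /=.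
  by apply: eq_bigr => i _; rewrite /b'; case: ifP; rewrite ?mul0r.
(* The first relation times [1 - b' 0], with [(1 - b' 0) * x ^+ m.+1] replaced by the polynomial
   that the second relation gives for it, and [b' 0] added to restore the total 1. *)
pose c i := (if i == 0%N then b' 0%N else 0) + ((1 - b' 0%N) * a i + a m.+1 * b' (m.+1 - i)%N).
have Ec i : E (c i).
  apply: (submodD sE); first by case: ifP => _ //; apply: submod0 sE.
  apply: (submodD sE); apply: (submodM sE) => //; last exact: EC.
  by case: (sC) => C1 CB _; apply: CB => //; apply: EC.
apply: (IH m.+1 l x c b _ x0 Ec Eb _ hb); first by move: mln; rewrite addSn.
under eq_bigr do rewrite mulrDl mulrDl -!mulrA.
rewrite !big_split /= -!mulr_sumr.
have -> : \sum_(i < m.+1) (if i == 0%N :> nat then b' 0%N else 0) * x ^+ i = b' 0%N.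
  rewrite big_ord_recl /= expr0 mulr1 big1 ?addr0 // => i _.
  by rewrite mul0r.
have -> : \sum_(i < m.+1) a i * x ^+ i = 1 - a m.+1 * x ^+ m.+1.
  by apply/esym/eqP; rewrite subr_eq; apply/eqP; rewrite -[LHS]ha [LHS]big_ord_recr.
have -> : \sum_(i < m.+1) b' (m.+1 - i)%N * x ^+ i = x ^+ m.+1 * (1 - b' 0%N).
  rewrite -[X in _ * (X - _)]hb' [X in _ * (X - _)]big_ord_recl /= expr0 mulr1.
  rewrite addrAC subrr add0r mulr_sumr.
  rewrite (reindex_inj rev_ord_inj); apply: eq_bigr => i _ /=.
  rewrite /bump /= add1n subSS.
  have -> : (m.+1 - (m - i) = i.+1)%N by have := ltn_ord i; lia.
  rewrite mulrCA; congr (_ * _).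
  have -> : x ^+ m.+1 = x ^+ (m - i) * x ^+ i.+1.
    by rewrite -exprD; congr (_ ^+ _); have := ltn_ord i; lia.
  by rewrite exprVn mulfK ?expf_neq0.
by ring.
Qed.

(** Chevalley's argument: take [V] maximal among the rings above [B] in which [N] generates a proper
    ideal. For [x] outside [V], maximality makes 1 a polynomial in [x] with coefficients in [N V];
    this cannot happen for both [x] and [x^-1]. *)
Theorem valuation_extension B N : ideal B N -> ~ N 1 -> subring B ->
  exists V, [/\ valring V, B `<=` V & N `<=` maxid V].
Proof.
move=> [sN NB] nN1 sB.
pose good C := [/\ subring C, B `<=` C & ~ ideal_gen N C 1].
have goodB : good B by split=> // h; apply: nN1; apply: ideal_gen_min h.
have [F FP totF|V [PV Vmax]] := @Zorn_bigcup K [set C | C = set0 \/ good C].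
  have [[C0 [FC0 gC0]]|nex] := pselect (exists C, F C /\ good C); last first.
    left; apply/seteqP; split=> // x [C FC Cx]; exfalso.
    have [C_0|gC] := FP _ FC; first by rewrite C_0 in Cx.
    by apply: nex; exists C.
  have FG C x : F C -> C x -> good C.
    by move=> FC Cx; have [C_0|//] := FP _ FC; rewrite C_0 in Cx.
  have join C D x y : F C -> C x -> F D -> D y -> exists E, [/\ F E, good E, E x & E y].
    move=> FC Cx FD Dy; case: (totF _ _ FC FD) => h.
      by exists D; split=> //; [exact: FG Dy|exact: h].
    by exists C; split=> //; [exact: FG Cx|exact: h].
  have [sC0 BC0 _] := gC0.
  right; split.
  - split.
    + by exists C0 => //; case: sC0.
    + move=> x y [C FC Cx] [D FD Dy]; have [E [FE [sE _ _] Ex Ey]] := join _ _ _ _ FC Cx FD Dy.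
      by exists E => //; case: sE => _ + _; apply.
    + move=> x y [C FC Cx] [D FD Dy]; have [E [FE [sE _ _] Ex Ey]] := join _ _ _ _ FC Cx FD Dy.
      by exists E => //; apply: subringM.
  - by move=> x Bx; exists C0 => //; apply: BC0.
  - have mono C D : C `<=` D -> ideal_gen N C `<=` ideal_gen N D.
      move=> CD; apply: ideal_gen_min; last exact: ideal_gen_mem.
      by have [h0 hD hM] := ideal_gen_submod N D; split=> // c z /CD; apply: hM.
    suff cpt x : ideal_gen N (\bigcup_(X in F) X) x ->
        exists C, [/\ F C, good C & ideal_gen N C x].
      by move=> /cpt[C [_ [_ _ nC] /nC]].
    elim=> [|y Ny|y z _ [C [FC gC gy]] _ [D [FD gD gz]]|c y [C FC Cc] _ [D [FD gD gy]]].
    + by exists C0; split=> //; constructor.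
    + by exists C0; split=> //; apply: ideal_gen_mem.
    + case: (totF _ _ FC FD) => h.
        by exists D; split=> //; apply: ideal_genD => //; apply: mono gy.
      by exists C; split=> //; apply: ideal_genD => //; apply: mono gz.
    + have gC := FG _ _ FC Cc; case: (totF _ _ FC FD) => h.
        by exists D; split=> //; apply: ideal_genM => //; apply: h.
      by exists C; split=> //; apply: ideal_genM => //; apply: mono gy.
have gV : good V.
  case: PV => // V0; exfalso; apply: (Vmax B); last by right.
  by rewrite V0; split=> // h; case: sB => /h.
have [sV BV nV1] := gV; have sE := ideal_gen_submod N V.
have EV : ideal_gen N V `<=` V.
  apply: ideal_gen_min; first exact: subring_submod.
  exact: subset_trans BV.
have ext x : ~ V x -> exists2 p : {poly K}, forall i, ideal_gen N V p`_i & p.[x] = 1.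
  move=> nVx; suff /ideal_gen_poly[p hp e] : ideal_gen N (poly_ext V x) 1 by exists p.
  apply: contrapT => n1; apply: (Vmax (poly_ext V x)).
    by split; [exact: poly_ext_sub|move=> /(_ x (poly_ext_mem _ sV))].
  right; split=> //; first exact: poly_ext_subring.
  by apply: subset_trans BV _; apply: poly_ext_sub.
exists V; split=> //.
  split=> // x x0; apply: contrapT => /not_orP[/ext[p hp p1] /ext[q hq q1]].
  move: p1 q1; rewrite !horner_coef.
  exact: (no_double_relation sV sE EV nV1 x0 hp hq).
move=> x Nx; have [->|x0] := eqVneq x 0; first by left.
right=> Vx1; apply: nV1; rewrite -(mulVf x0); apply: ideal_genM => //.
exact: ideal_gen_mem.
Qed.

(** [Q] consists of the elements whose value exceeds that of every [s] of [A] outside [P]. If [a]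
    and [b] fail this at [s] and [t], then [a * b] fails it at [s * t], again outside [P]. *)
Lemma valuation_prime_lift A V P : subring A -> valring V -> A `<=` V -> prime_ideal A P ->
  (forall a s, P a -> A s -> ~ P s -> maxid V (a / s)) ->
  let Q := [set v | V v /\ forall s, A s -> ~ P s -> maxid V (v / s)] in
  prime_ideal V Q /\ Q `&` A = P.
Proof.
move=> sA vV AV pP hP Q; have [sV tV] := vV; have sM := maxid_submod vV.
have nP1 := prime_ideal1 pP; have A1 : A 1 by case: sA.
have V1 : V 1 by exact: AV.
split; last first.
  apply/seteqP; split=> x.
    move=> [[_ h] Ax]; apply: contrapT => nPx; apply: (maxid1 vV).
    by rewrite -(divff (notin_prime_neq0 pP nPx)); apply: h.
  move=> Px; have Ax := prime_ideal_sub pP Px; split=> //; split; first exact: AV.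
  by move=> s As nPs; apply: hP.
split.
- split=> [|x []//]; split.
  + by split=> [|s _ _]; [exact: subring0|rewrite mul0r; left].
  + move=> x y [Vx hx] [Vy hy]; split=> [|s As nPs]; first exact: subringD.
    by rewrite mulrDl; apply: maxidD => //; [apply: hx|apply: hy].
  + move=> a x Va [Vx hx]; split=> [|s As nPs]; first exact: subringM.
    by rewrite -mulrA; apply: maxidM => //; apply: hx.
- move=> e; have : Q 1 by rewrite e.
  by case=> _ /(_ 1 A1 nP1); rewrite divr1; apply: maxid1.
- move=> a b Va Vb [_ hab]; apply: contrapT => /not_orP[na nb].
  have aux v : V v -> ~ Q v -> v != 0 /\ exists s, [/\ A s, ~ P s & V (s / v)].
    move=> Vv nQv; split.
      apply/eqP => v0; apply: nQv; split=> // s _ _; rewrite v0 mul0r; exact: submod0 sM.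
    apply: contrapT => nex; apply: nQv; split=> // s As nPs; right => h; apply: nex.
    by exists s; split=> //; rewrite -invf_div.
  have [a0 [s [As nPs Vsa]]] := aux a Va na; have [b0 [t [At nPt Vtb]]] := aux b Vb nb.
  have s0 := notin_prime_neq0 pP nPs; have t0 := notin_prime_neq0 pP nPt.
  apply: (maxid1 vV).
  have -> : 1 = (s / a) * (t / b) * (a * b / (s * t)) by field; rewrite a0 b0 s0 t0.
  apply: (submodM sM); first exact: subringM.
  by apply: hab; [exact: subringM|exact: (prime_ideal_mul pP)].
Qed.

(* The sum [N] of the [P_i A_(P_i)] is closed under products and does not
   contain 1, so some valuation ring [V] contains [A] and has [N] in its maximal
   ideal. For [a] in [P_i] and [s] in [A \ P_i], it follows that [v(a) > v(s)]. *)
Theorem lift_prime_chain A (P : nat -> set K) n : subring A ->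
  (forall i, (i <= n)%N -> prime_ideal A (P i)) ->
  (forall i, (i < n)%N -> P i `<=` P i.+1) ->
  (forall i, (i < n)%N -> ~ (P i.+1 `<=` P i)) ->
  exists V (Q : nat -> set K), [/\ valring V, A `<=` V,
    forall i, (i <= n)%N -> prime_ideal V (Q i),
    forall i, (i < n)%N -> Q i `<=` Q i.+1 &
    forall i, (i < n)%N -> ~ (Q i.+1 `<=` Q i)].
Proof.
move=> sA pP PS nP.
have mP i j : (i <= j)%N -> (j <= n)%N -> P i `<=` P j.
  elim: j => [|j IH]; first by rewrite leqn0 => /eqP -> _; exact: subset_refl.
  rewrite leq_eqVlt => /orP[/eqP -> _|]; first exact: subset_refl.
  rewrite ltnS => ij jn.
  by apply: subset_trans (IH ij (ltnW jn)) _; apply: PS.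
pose L i := localization A (P i); pose p i := ext_prime A (P i) (P i).
have AL i : (i <= n)%N -> A `<=` L i by move=> /pP; apply: loc_sub.
have LL i j : (i <= j)%N -> (j <= n)%N -> L j `<=` L i.
  by move=> ij jn _ [a [s [Aa As nPs ->]]]; exists a, s; split=> // /(mP _ _ ij jn).
have pp i : (i <= n)%N -> prime_ideal (L i) (p i).
  by move=> /pP h; apply: ext_prime_prime.
have sp i : (i <= n)%N -> submod (L i) (p i) by move=> /pp[[]].
have pL i : (i <= n)%N -> p i `<=` L i by move=> /pp[[]].
pose N k := [set x | exists y : nat -> K, (forall i, (i <= k)%N -> p i (y i)) /\
  x = \sum_(i < k.+1) y i].
have sN k : (k <= n)%N -> submod A (N k).
  move=> kn; split.
  - exists (fun=> 0); split; last by rewrite big1.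
    by move=> i ik; apply: submod0 (sp i _); apply: leq_trans kn.
  - move=> _ _ [y [py ->]] [z [pz ->]]; exists (fun i => y i + z i).
    split; last by rewrite big_split.
    by move=> i ik; apply: (submodD (sp i (leq_trans ik kn))); [apply: py|apply: pz].
  - move=> a _ Aa [y [py ->]]; exists (fun i => a * y i); split; last by rewrite mulr_sumr.
    move=> i ik; apply: (submodM (sp i (leq_trans ik kn))); last exact: py.
    by apply: AL => //; apply: leq_trans kn.
have pN i x : (i <= n)%N -> p i x -> N n x.
  move=> ii px; exists (fun j => if j == i then x else 0); split.
    by move=> j jn; case: eqP => [-> //|_]; apply: submod0 (sp j jn).
  rewrite -ltnS in ii; rewrite (bigD1 (Ordinal ii)) //= eqxx big1 ?addr0 // => j.
  by rewrite -val_eqE /= => /negbTE ->.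
(* For [i <= j] one has [p j <= L j <= L i], so the product of [p i] and [p j] stays in [p i]. *)
have NM x y : N n x -> N n y -> N n (x * y).
  move=> [u [pu ->]] [w [pw ->]]; rewrite mulr_suml.
  apply: (submod_sum _ (sN n (leqnn n))) => i _; rewrite mulr_sumr.
  apply: (submod_sum _ (sN n (leqnn n))) => j _.
  have iin : (i <= n)%N := ltn_ord i; have jn : (j <= n)%N := ltn_ord j.
  case: (leqP i j) => [ij|/ltnW ji].
    apply: (pN i) => //; rewrite mulrC; apply: (submodM (sp i iin)); last exact: pu.
    by apply: (LL i j) => //; apply: pL => //; apply: pw.
  apply: (pN j) => //; apply: (submodM (sp j jn)); last exact: pw.
  by apply: (LL j i) => //; apply: pL => //; apply: pu.
have down k x : (k < n)%N -> p k x -> L k.+1 x -> p k.+1 x.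
  move=> kn [a [s [Pa As nPs xa]]] [b [t [Ab At nPt xb]]].
  exists b, t; split=> //; apply: (PS k kn).
  have pk := pP k (ltnW kn); have [[sPk _] _ hPk] := pk.
  have s0 := notin_prime_neq0 pk nPs; have t0 := notin_prime_neq0 (pP _ kn) nPt.
  case: (hPk s b As Ab) => //; have -> : s * b = t * a.
    have : a / s = b / t by rewrite -xa.
    by move/eqP; rewrite eqr_div // => /eqP e; rewrite mulrC -e mulrC.
  exact: (submodM sPk).
(* This is what keeps 1 out of [N n]. Without its last summand the sum still lies in [L k.+1], hence
   in [L k], hence in [p k] by induction, and [down] carries it to [p k.+1]. *)
have Np k x : (k <= n)%N -> N k x -> L k x -> p k x.
  elim: k x => [|k IH] x kn [y [py ->]] Lx; first by rewrite big_ord1; apply: py.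
  rewrite big_ord_recr /= in Lx *; have pyk : p k.+1 (y k.+1) by apply: py.
  apply: (submodD (sp _ kn)) => //; apply: down => //.
    apply: IH; first exact: ltnW.
      by exists y; split=> // i ik; apply: py; apply: leq_trans ik _.
    apply: (LL k k.+1) => //; rewrite -(addrK (y k.+1) (\sum_(_ < _) _)).
    by case: (loc_subring sA (pP _ kn)) => _ + _; apply=> //; apply: pL.
  rewrite -(addrK (y k.+1) (\sum_(_ < _) _)).
  by case: (loc_subring sA (pP _ kn)) => _ + _; apply=> //; apply: pL.
have A1 : A 1 by case: sA.
have nN1 : ~ N n 1.
  move=> /(Np n _ (leqnn n)) h; apply: (prime_ideal1 (pp n (leqnn n))); apply: h.
  exact: AL.
have sNn := sN n (leqnn n).
pose B := sum_mod A (N n).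
have AB : A `<=` B by move=> a Aa; exists a, 0; split=> //; [exact: submod0 sNn|rewrite addr0].
have NB : N n `<=` B by move=> x Nx; exists 0, x; split=> //; [exact: subring0|rewrite add0r].
have sB : subring B.
  split; first exact: AB.
    move=> _ _ [a [x [Aa Nx ->]]] [b [y [Ab Ny ->]]]; exists (a - b), (x - y); split.
    - by case: (sA) => _ + _; apply.
    - exact: (submodB sA sNn).
    - by rewrite opprD addrACA.
  move=> _ _ [a [x [Aa Nx ->]]] [b [y [Ab Ny ->]]].
  exists (a * b), (a * y + (b * x + x * y)); split; [exact: subringM| |by ring].
  apply: (submodD sNn); first exact: (submodM sNn).
  by apply: (submodD sNn); [exact: (submodM sNn)|exact: NM].
have iN : ideal B (N n).
  split=> //; split; [exact: submod0 sNn|by move=> x y; apply: (submodD sNn)|].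
  move=> _ y [a [x [Aa Nx ->]]] Ny; rewrite mulrDl.
  by apply: (submodD sNn); [exact: (submodM sNn)|exact: NM].
have [V [vV BV NV]] := valuation_extension iN nN1 sB.
have AV : A `<=` V by apply: subset_trans BV.
have key i : (i <= n)%N -> forall a s, P i a -> A s -> ~ P i s -> maxid V (a / s).
  by move=> ii a s Pa As nPs; apply/NV/(pN i) => //; exists a, s.
pose Q i := [set v | V v /\ forall s, A s -> ~ P i s -> maxid V (v / s)].
have QP i (ii : (i <= n)%N) := valuation_prime_lift sA vV AV (pP i ii) (key i ii).
exists V, Q; split=> //.
- by move=> i /QP[].
- by move=> i ii x [Vx hx]; split=> // s As nPs; apply: hx => // /(PS i ii).
- move=> i ii QQ; apply: (nP i ii) => x Px.
  have [_ e] := QP _ ii; have [_ e'] := QP _ (ltnW ii).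
  by move: Px; rewrite -e -e' => -[/QQ Qx Ax].
Qed.

End ValuationOverrings.

(** * Semistar operations: passage between quasi-primes, localizations and star-valuation
    overrings *)

Section Semistar.
Variable K : fieldType.
Implicit Types (A E F G I J M P Q R V : set K) (x y z : K) (star : set K -> set K).

Lemma span_submodule A n (g : 'I_n -> K) : subring A -> submod A (Defs.span A g).
Proof.
move=> sA; split.
- exists (fun=> 0); first by move=> _; exact: subring0.
  by rewrite big1 // => i _; rewrite mul0r.
- move=> _ _ [c Ac ->] [d Ad ->]; exists (fun i => c i + d i).
    by move=> i; apply: subringD.
  by rewrite -big_split; apply: eq_bigr => i _; rewrite mulrDl.
- move=> a _ Aa [c Ac ->]; exists (fun i => a * c i); first by move=> i; apply: subringM.
  by rewrite mulr_sumr; apply: eq_bigr => i _; rewrite mulrA.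
Qed.

Lemma span_generator A n (g : 'I_n -> K) i : subring A -> Defs.span A g (g i).
Proof.
move=> sA; exists (fun j => if j == i then 1 else 0).
  by move=> j; case: ifP => _; [case: sA|exact: subring0].
by rewrite (bigD1 i) //= eqxx mul1r big1 ?addr0 // => j /negbTE ->; rewrite mul0r.
Qed.

Lemma span_least A n (g : 'I_n -> K) E : submod A E -> (forall i, E (g i)) -> Defs.span A g `<=` E.
Proof.
move=> sE Eg _ [c Ac ->]; apply: (submod_sum _ sE) => i _.
exact: (submodM sE).
Qed.

Lemma nz_fg_nz A F : subring A -> nz_fg_submod A F -> nz_submod A F.
Proof. by move=> sA [nzF [n [g e]]]; split=> //; rewrite e; apply: span_submodule. Qed.

Lemma nz_fg_one A x : subring A -> x != 0 -> exists2 F, nz_fg_submod A F &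
  F x /\ forall E, submod A E -> E x -> F `<=` E.
Proof.
move=> sA x0; pose g (i : 'I_1) := x.
have gx : Defs.span A g x by apply: (span_generator g ord0).
exists (Defs.span A g); first by split; [exists x|exists 1%N, g].
by split=> // E sE Ex; apply: span_least.
Qed.

Lemma nz_fg_add A F G I : subring A -> submod A I -> nz_fg_submod A F -> nz_fg_submod A G ->
  F `<=` I -> G `<=` I -> exists H, [/\ nz_fg_submod A H, F `<=` H, G `<=` H & H `<=` I].
Proof.
move=> sA sI [[x Fx x0] [n [f eF]]] [_ [m [g eG]]] FI GI.
pose h (i : 'I_(n + m)) := match split i with inl j => f j | inr j => g j end.
have hl j : h (lshift m j) = f j by rewrite /h (unsplitK (inl _ j)).
have hr j : h (rshift n j) = g j by rewrite /h (unsplitK (inr _ j)).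
have sH := span_submodule h sA.
have FH : F `<=` Defs.span A h.
  by rewrite eF; apply: span_least => // j; rewrite -hl; apply: span_generator.
have GH : G `<=` Defs.span A h.
  by rewrite eG; apply: span_least => // j; rewrite -hr; apply: span_generator.
exists (Defs.span A h); split=> //.
- by split; [exists x => //; apply: FH|exists (n + m)%N, h].
- apply: span_least => // i; rewrite /h; case: (split i) => j.
    by apply: FI; rewrite eF; apply: span_generator.
  by apply: GI; rewrite eG; apply: span_generator.
Qed.

Lemma star_mono A star E F : semistar A star -> nz_submod A E -> nz_submod A F ->
  E `<=` F -> star E `<=` star F.
Proof. by case=> _ _ + _; apply. Qed.

(** The finitely generated submodules of [I] are directed, so one of them serves all of [s]. *)
Lemma star_f_seq A star I (s : seq K) : subring A -> semistar A star -> nz_submod A I ->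
  (forall x, x \in s -> star_f A star I x) ->
  exists F, [/\ nz_fg_submod A F, F `<=` I & forall x, x \in s -> star F x].
Proof.
move=> sA sS [sI [z Iz z0]]; elim: s => [|x s IH] hs.
  by have [F hF [_ FI]] := nz_fg_one sA z0; exists F; split=> //; apply: FI.
have [|F [hF FI sF]] := IH; first by move=> y ys; apply: hs; rewrite inE ys orbT.
have [G [hG GI] sG] := hs x (mem_head _ _).
have [H [hH FH GH HI]] := nz_fg_add sA sI hF hG FI GI.
have [nF nG nH] : [/\ nz_submod A F, nz_submod A G & nz_submod A H].
  by split; apply: nz_fg_nz.
exists H; split=> // y; rewrite inE => /orP[/eqP ->|/sF].
  exact: (star_mono sS nG nH GH).
exact: (star_mono sS nF nH FH).
Qed.

Lemma star_f_submod A star I : subring A -> semistar A star -> nz_submod A I ->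
  submod A (star_f A star I).
Proof.
move=> sA sS nI; have [stnz _ _ _] := sS.
have two x y : star_f A star I x -> star_f A star I y ->
    exists F, [/\ nz_fg_submod A F, F `<=` I, star F x & star F y].
  move=> hx hy; have [|F [hF FI hs]] := @star_f_seq A star I [:: x; y] sA sS nI.
    by move=> z; rewrite !inE => /orP[/eqP ->|/eqP ->].
  by exists F; split=> //; apply: hs; rewrite !inE eqxx ?orbT.
have sF F : nz_fg_submod A F -> submod A (star F).
  by move=> /(nz_fg_nz sA)/stnz[].
split.
- have [F [hF FI _]] : exists F, [/\ nz_fg_submod A F, F `<=` I & forall x, x \in [::] -> star F x].
    exact: star_f_seq.
  by exists F => //; apply: submod0 (sF F hF).
- move=> x y hx hy; have [F [hF FI Fx Fy]] := two _ _ hx hy.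
  by exists F => //; apply: (submodD (sF F hF)).
- by move=> a x Aa [F [hF FI] Fx]; exists F => //; apply: (submodM (sF F hF)).
Qed.

Lemma star_f_sub A star I : subring A -> semistar A star -> nz_submod A I -> I `<=` star_f A star I.
Proof.
move=> sA sS nI x Ix; have [_ _ _ stX] := sS.
have [->|x0] := eqVneq x 0; first exact: (submod0 (star_f_submod sA sS nI)).
have [sI _] := nI; have [F hF [Fx FI]] := nz_fg_one sA x0.
exists F; first by split=> //; apply: FI.
by have [h _] := stX F (nz_fg_nz sA hF); apply: h.
Qed.

(** The finitely many generators of [G] already lie in one [star F], whence
    [star G <= star (star F) = star F]. *)
Lemma star_f_idem A star I J : subring A -> semistar A star -> nz_submod A I ->
  J `<=` star_f A star I -> star_f A star J `<=` star_f A star I.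
Proof.
move=> sA sS nI JI x [G [hG GJ] Gx]; have [stnz _ _ stX] := sS.
have [_ [n [g eG]]] := hG.
have [|F [hF FI hF']] := @star_f_seq A star I [seq g i | i <- enum 'I_n] sA sS nI.
  move=> _ /mapP[i _ ->]; apply: JI; apply: GJ; rewrite eG; exact: span_generator.
have nF := nz_fg_nz sA hF; exists F => //.
have [_ <-] := stX F nF.
apply: (star_mono sS (nz_fg_nz sA hG) (stnz F nF) _ Gx).
rewrite eG; apply: span_least; first by case: (stnz F nF).
by move=> i; apply: hF'; apply: map_f; rewrite mem_enum.
Qed.

(* The union of a chain of ideals is handled by finite generation. *)
Lemma qmax_above A star I : subring A -> semistar A star -> ideal A I -> nonzero_set I ->
  ~ star_f A star I 1 -> exists2 M, qmax A (star_f A star) M & I `<=` M.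
Proof.
move=> sA sS iI nzI nI1; have A1 : A 1 by case: sA.
(* Only properness of the closure is imposed. A maximal [M] is then a quasi-ideal, because the trace
   of its closure on [A] is good again by idempotence. *)
pose good J := [/\ ideal A J, I `<=` J & ~ star_f A star J 1].
have gI : good I by split=> //; exact: subset_refl.
have [F FP totF|M [PM Mmax]] := @Zorn_bigcup K [set J | J = set0 \/ good J].
  have [[C0 [FC0 gC0]]|nex] := pselect (exists C, F C /\ good C); last first.
    left; apply/seteqP; split=> // x [C FC Cx]; exfalso.
    have [C_0|gC] := FP _ FC; first by rewrite C_0 in Cx.
    by apply: nex; exists C.
  have FG C x : F C -> C x -> good C.
    by move=> FC Cx; have [C_0|//] := FP _ FC; rewrite C_0 in Cx.
  have join C D x y : F C -> C x -> F D -> D y -> exists E, [/\ F E, good E, E x & E y].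
    move=> FC Cx FD Dy; case: (totF _ _ FC FD) => h.
      by exists D; split=> //; [exact: FG Dy|exact: h].
    by exists C; split=> //; [exact: FG Cx|exact: h].
  have [[sC0 C0A] IC0 _] := gC0.
  have sU : submod A (\bigcup_(X in F) X).
    split.
    - by exists C0 => //; apply: submod0 sC0.
    - move=> x y [C FC Cx] [D FD Dy]; have [E [FE [[sE _] _ _] Ex Ey]] := join _ _ _ _ FC Cx FD Dy.
      by exists E => //; apply: (submodD sE).
    - move=> a x Aa [C FC Cx]; have [[sC _] _ _] := FG _ _ FC Cx.
      by exists C => //; apply: (submodM sC).
  right; split.
  - split=> // x [C FC Cx]; have [[_ CA] _ _] := FG _ _ FC Cx; exact: CA.
  - by move=> x Ix; exists C0 => //; apply: IC0.
  - move=> [G [hG GU] G1]; have [_ [n [g eG]]] := hG.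
    have cpt (s : seq K) : (forall x, x \in s -> (\bigcup_(X in F) X) x) ->
        exists C, [/\ F C, good C & forall x, x \in s -> C x].
      elim: s => [|x s IH] hs; first by exists C0.
      have [|C [FC gC hC]] := IH; first by move=> y ys; apply: hs; rewrite inE ys orbT.
      have [D FD Dx] := hs x (mem_head _ _); case: (totF _ _ FC FD) => h.
        exists D; split=> //; first exact: FG Dx.
        by move=> y; rewrite inE => /orP[/eqP -> //|/hC /h].
      exists C; split=> // y; rewrite inE => /orP[/eqP ->|/hC //]; exact: h.
    have [|C [FC [[sC _] _ nC1] hC]] := cpt [seq g i | i <- enum 'I_n].
      by move=> _ /mapP[i _ ->]; apply: GU; rewrite eG; apply: span_generator.
    apply: nC1; exists G => //; split=> //; rewrite eG; apply: span_least => // i.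
    by apply: hC; apply: map_f; rewrite mem_enum.
have gM : good M.
  case: PM => // M0; exfalso; apply: (Mmax I); last by right.
  by rewrite M0; split=> // h; case: nzI => x /h.
have [iM IM nM1] := gM; have [sM MA] := iM.
have nzM : nonzero_set M by case: nzI => x /IM Mx x0; exists x.
have nM : nz_submod A M by [].
have sfM := star_f_submod sA sS nM.
have max J : good J -> M `<=` J -> J = M.
  move=> gJ MJ; apply: contrapT => nJM; apply: (Mmax J); last by right.
  by split=> // JM; apply: nJM; apply/seteqP.
exists M => //; split.
- split=> //; apply: max; last first.
    by move=> x Mx; split; [exact: star_f_sub|exact: MA].
  split.
  + by split; [exact: setI_submod (subring_submod sA)|move=> x []].
  + by move=> x /IM Mx; split; [exact: star_f_sub|exact: MA].
  + by move=> h; apply: nM1; apply: (star_f_idem sA sS nM _ h) => x [].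
- by move=> e; apply: nM1; apply: star_f_sub => //; rewrite e.
- move=> J [iJ nzJ eJ] nJA MJ; apply: max => //; split=> //.
    exact: subset_trans MJ.
  by move=> h; apply: nJA; apply: ideal_eq => //; rewrite -eJ.
Qed.

Lemma mul_set_mono E F G : F `<=` G -> mul_set E F `<=` mul_set E G.
Proof.
move=> FG _ [n [e [f [h ->]]]]; exists n, e, f; split=> // i.
by have [? /FG] := h i.
Qed.

Lemma mul_set_min R E F J : submod R J -> F `<=` R -> E `<=` J -> mul_set E F `<=` J.
Proof.
move=> sJ FR EJ _ [n [e [f [h ->]]]]; apply: (submod_sum _ sJ) => i _.
by have [/EJ Je /FR Rf] := h i; rewrite mulrC; apply: (submodM sJ).
Qed.

Lemma mul_set_one E F x y : E x -> F y -> mul_set E F (x * y).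
Proof.
move=> Ex Fy; exists 1%N, (fun=> x), (fun=> y); split=> //.
by rewrite big_ord1.
Qed.

Lemma qmax1 A star M : qmax A star M -> ~ M 1 /\ ideal A M.
Proof. by move=> [[iM _ _] nMA _]; split=> // M1; apply: nMA; apply: ideal_eq. Qed.

Lemma loc_anti A P M : P `<=` M -> localization A M `<=` localization A P.
Proof. by move=> PM _ [a [s [Aa As nMs ->]]]; exists a, s; split=> // /PM. Qed.

Lemma star_tilde_sub A star I : subring A -> I `<=` star_tilde A star I.
Proof.
move=> sA x Ix M /qmax1[M1 _]; rewrite -[x]mulr1; apply: mul_set_one => //.
by exists 1, 1; split; [case: sA|case: sA|exact: M1|rewrite divr1].
Qed.

(** One member of the intersection defining [star_tilde] suffices: [P <= M] gives [A_M <= A_P], so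
    the closure of the contraction stays in [J]. The chain condition and the dimension bound pass
    from [A] to [A_P] by this. *)
Lemma contract_quasi_ideal A star M P J : subring A -> qmax A (star_f A star) M ->
  prime_ideal A P -> P `<=` M -> ideal (localization A P) J -> nonzero_set J ->
  quasi_ideal A (star_tilde A star) (J `&` A).
Proof.
move=> sA qM pP PM iJ [z Jz z0]; have [sJ JL] := iJ; have AL := loc_sub sA pP.
split.
- exact: contract_ideal AL iJ.
- have [a [s [Aa As nPs e]]] := JL _ Jz; have s0 := notin_prime_neq0 pP nPs.
  have ea : a = s * z by rewrite e mulrC divfK.
  exists a; last by rewrite ea mulf_neq0.
  by split=> //; rewrite ea; apply: (submodM sJ) => //; apply: AL.
- apply/seteqP; split=> x; last by move=> h; split; [exact: star_tilde_sub|case: h].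
  move=> [/(_ M qM) h Ax]; split=> //.
  apply: (mul_set_min sJ _ _ h); first exact: loc_anti.
  by move=> y [].
Qed.

Lemma noeth_loc_star A star M P : subring A -> star_noetherian A (star_tilde A star) ->
  qmax A (star_f A star) M -> prime_ideal A P -> P `<=` M -> noeth (localization A P).
Proof.
move=> sA nA qM pP PM I iI mI.
(* Quasi-ideals are nonzero, so the sequence is followed from a nonzero member on; if there is none,
   it is constant. *)
have [[k0 nz0]|nz] := pselect (exists k, nonzero_set (I k)); last first.
  have zero k : I k = [set 0].
    apply/seteqP; split=> x; last by move=> ->; case: (iI k) => /submod0.
    move=> Ix; apply: contrapT => /eqP x0; apply: nz; exists k; by exists x.
  by exists 0%N => k _; rewrite !zero.
have nzk k : nonzero_set (I (k + k0)%N).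
  by elim: k => //= k [x Ix x0]; exists x => //; apply: mI.
have [||N hN] := nA (fun k => I (k + k0)%N `&` A).
- by move=> k; apply: (contract_quasi_ideal sA qM pP PM).
- by move=> k x [Ix Ax]; split=> //; apply: mI.
exists (N + k0)%N => k hk.
apply: (loc_contract_inj sA pP (iI _) (iI _)).
have le1 : (N <= k - k0)%N by lia.
by have := hN _ le1; have -> : (k - k0 + k0 = k)%N by lia.
Qed.

Lemma quasi_prime_below A star M P Q : subring A -> qmax A (star_f A star) M ->
  prime_ideal A P -> P `<=` M -> prime_ideal A Q -> Q `<=` P -> nonzero_set Q ->
  quasi_prime A (star_tilde A star) Q.
Proof.
move=> sA qM pP PM pQ QP [z Qz z0]; split=> //.
rewrite -(ext_primeI sA pP pQ QP).
have [iJ _ _] := ext_prime_prime sA pP pQ QP.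
apply: (contract_quasi_ideal sA qM pP PM iJ).
by exists z => //; apply: ext_prime_in.
Qed.

Lemma pchain_fun R P k Q : pchain R P k Q -> exists f : nat -> set K,
  [/\ f 0%N = P, f k = Q & forall i, (i < k)%N ->
    [/\ f i `<=` f i.+1, ~ (f i.+1 `<=` f i) & prime_ideal R (f i.+1)]].
Proof.
elim=> [|l B C _ [f [f0 fl hf]] BC nBC pC]; first by exists (fun=> P).
exists (fun i => if (i <= l)%N then f i else C); split=> //; first by rewrite ltnn.
move=> i; rewrite ltnS => il; rewrite il; case: (ltnP i l) => h; first exact: hf.
have -> : i = l by lia.
by rewrite fl; split=> // CB; apply: nBC; apply/seteqP.
Qed.

Lemma star_dim_chain A star n M P k Q : subring A ->
  star_dim A (star_tilde A star) n -> qmax A (star_f A star) M -> prime_ideal A P ->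
  P `<=` M -> pchain (localization A P) [set 0] k Q -> (k <= n)%N.
Proof.
move=> sA [ub _] qM pP PM ch; have sR := loc_subring sA pP.
have pR0 := zero_prime sR; have := ch => /(pchain_contract sA pP pR0).
have -> : [set 0] `&` A = [set 0].
  by apply/seteqP; split=> [x []//|_ ->]; split=> //; apply: subring0.
move=> chA; have pQ : prime_ideal (localization A P) Q by case: ch.
have [f [f0 fk hf]] := pchain_fun chA.
have QP : Q `&` A `<=` P.
  move=> x [Qx Ax]; rewrite -(ext_primeI sA pP pP (@subset_refl _ _)); split=> //.
  exact: (loc_prime_sub sA pP pQ).
have mf i j : (i <= j)%N -> (j <= k)%N -> f i `<=` f j.
  elim: j => [|j IH]; first by rewrite leqn0 => /eqP -> _; exact: subset_refl.
  rewrite leq_eqVlt => /orP[/eqP -> _|]; first exact: subset_refl.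
  rewrite ltnS => ij jk; have [h _ _] := hf j jk.
  by apply: subset_trans (IH ij (ltnW jk)) h.
have f00 i : (i <= k)%N -> f i 0.
  by move=> ik; apply: (mf 0%N i) => //; rewrite f0.
(* [k] steps starting at the zero ideal leave [k] nonzero primes once [f 0] is dropped. *)
apply: ub; exists (fun i : 'I_k => f i.+1); split=> [i|i j ij].
  have [h1 h2 h3] := hf i (ltn_ord i).
  apply: (quasi_prime_below sA qM pP PM h3).
    by apply: subset_trans QP; rewrite -fk; apply: mf.
  have [x fx nfx] := notsub_ex h2; exists x => //.
  by apply/eqP => x0; apply: nfx; rewrite x0; apply: f00; apply: ltnW.
split; first by apply: mf; [exact: ltnW|exact: ltn_ord].
have [h1 h2 h3] := hf j (ltn_ord j).
by move=> h; apply: h2; apply: subset_trans h _; apply: mf => //; apply: ltnW; apply: ltn_ord.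
Qed.

(** If 1 were in [star F] for a finitely generated [F <= P], no [M] in QMax could contain [F], so 1
    would lie in every [F A_M], hence in the tilde closure of [F], hence in [F V <= maxid V]. *)
Lemma center_below_qmax A star V (P := maxid V `&` A) : subring A -> semistar A star ->
  valring V -> A `<=` V ->
  (forall F, nz_fg_submod A F -> star_tilde A star F `<=` mul_set F V) ->
  nonzero_set P -> exists2 M, qmax A (star_f A star) M & P `<=` M.
Proof.
move=> sA sS vV AV starV nzP; have A1 : A 1 by case: sA.
have pP : prime_ideal A P by apply: contract_prime (maxid_prime vV).
have [iP _ _] := pP; apply: qmax_above => // -[F [hF FP] F1].
apply: (maxid1 vV); have FV : mul_set F V `<=` maxid V.
  by apply: (mul_set_min (maxid_submod vV)) => // x /FP[].
apply/FV/starV => // M qM; have [M1 iM] := qmax1 qM.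
have [x Fx nMx] : exists2 x, F x & ~ M x.
  apply: notsub_ex => FM; apply: M1; case: (qM) => -[_ _ <-] _ _.
  by split=> //; exists F.
have Ax : A x by case: (FP _ Fx).
have x0 : x != 0 by apply/eqP => x0; apply: nMx; rewrite x0; case: iM => /submod0.
by rewrite -(divff x0); apply: mul_set_one => //; exists 1, x; rewrite div1r.
Qed.

Lemma star_valuation_chain_le A star n V (Q : nat -> set K) m : subring A ->
  semistar A star -> star_noetherian A (star_tilde A star) ->
  star_dim A (star_tilde A star) n ->
  (forall x, exists a s, [/\ A a, A s, s != 0 & x = a / s]) ->
  valring V -> A `<=` V ->
  (forall F, nz_fg_submod A F -> star_tilde A star F `<=` mul_set F V) ->
  (forall i, (i <= m)%N -> prime_ideal V (Q i)) ->
  (forall i, (i < m)%N -> Q i `<=` Q i.+1) ->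
  (forall i, (i < m)%N -> ~ (Q i.+1 `<=` Q i)) -> (m <= n)%N.
Proof.
move=> sA sS nA dA fA vV AV starV pQ QS nQ; have [sV _] := vV.
(* With zero center every nonzero element of [A] is invertible in [V], so [V = K] and [m = 0]. *)
have [nzP|zP] := pselect (nonzero_set (maxid V `&` A)); last first.
  have VK x : V x.
    have [a [s [Aa As s0 ->]]] := fA x; apply: subringM => //; first exact: AV.
    apply: contrapT => nVs; apply: zP; exists s => //; split=> //; by right.
  case: m pQ QS nQ => // m pQ QS nQ; exfalso.
  have [x Qx nQx] := notsub_ex (nQ 0%N isT).
  have p1 := pQ 1%N isT; have [[sQ1 _] _ _] := p1.
  have x0 : x != 0.
    by apply/eqP => x0; apply: nQx; rewrite x0; apply: prime_ideal0 (pQ 0%N isT).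
  by apply: (prime_ideal1 p1); rewrite -(mulVf x0); apply: (submodM sQ1).
have [M qM PM] := center_below_qmax sA sS vV AV starV nzP.
set P := maxid V `&` A in nzP PM.
have pP : prime_ideal A P by apply: contract_prime (maxid_prime vV).
have sR := loc_subring sA pP; have AR := loc_sub sA pP.
apply: (valuation_chain_le sR (noeth_loc_star sA nA qM pP PM) _ _ vV _ pQ QS nQ).
- move=> x; have [a [s [Aa As s0 ->]]] := fA x; exists a, s; split=> //; exact: AR.
- by move=> k C; apply: (star_dim_chain sA dA qM pP PM).
- move=> _ [a [s [Aa As nPs ->]]]; apply: subringM => //; first exact: AV.
  by apply: contrapT => nVs; apply: nPs; split=> //; right.
Qed.

Lemma supremums_nat_mem (S : set nat) n : S 0%N -> supremums S n -> S n.
Proof.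
move=> S0 [ub lb].
have ex : exists k, `[< S k >] by exists 0%N; apply/asboolP.
have bd k : `[< S k >] -> (k <= n)%N by move/asboolP/ub.
case: (ex_maxnP ex bd) => m /asboolP Sm mmax.
suff -> : n = m by [].
apply/eqP; rewrite eqn_leq; apply/andP; split; last by apply: ub.
by apply: lb => k Sk; apply: mmax; apply/asboolP.
Qed.

Lemma krull_dim_le V n : subring V ->
  (forall (Q : nat -> set K) m, (forall i, (i <= m)%N -> prime_ideal V (Q i)) ->
    (forall i, (i < m)%N -> Q i `<=` Q i.+1) ->
    (forall i, (i < m)%N -> ~ (Q i.+1 `<=` Q i)) -> (m <= n)%N) ->
  forall m (P : 'I_m.+1 -> set K), (forall i, prime_ideal V (P i)) ->
     (forall i j : 'I_m.+1, (i < j)%N -> P i `<` P j) -> (m <= n)%N.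
Proof.
move=> sV H m P pP mP; apply: (H (fun i => P (inord i))) => [i _|i im|i im].
- exact: pP.
- by have [|] := mP (inord i) (inord i.+1); first (by rewrite !inordK; lia).
- by have [|] := mP (inord i) (inord i.+1); first by rewrite !inordK; lia.
Qed.

Lemma valuation_overringP A V : valuation_overring A V <-> valring V /\ A `<=` V.
Proof.
have e : subring_closed (mem V) <-> subring V.
  split=> [[V1 VB VM]|[V1 VB VM]].
    split; first by have := V1; rewrite inE.
      by move=> x y Vx Vy; have := VB x y; rewrite !inE; apply.
    by move=> x y Vx Vy; have := VM x y; rewrite !inE; apply.
  split; first by rewrite inE.
    by move=> x y; rewrite !inE; apply: VB.
  by move=> x y; rewrite !inE; apply: VM.
split; first by case=> /e ? ? ?.
by case=> -[/e ? ?] ?.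
Qed.

Lemma star_valuation_of_dim A star n : subring A ->
  (forall x, exists a s, [/\ A a, A s, s != 0 & x = a / s]) ->
  star_dim A (star_tilde A star) n ->
  exists V (Q : nat -> set K), [/\ valring V /\ A `<=` V,
    forall F, nz_fg_submod A F -> star_tilde A star F `<=` mul_set F V,
    forall i, (i <= n)%N -> prime_ideal V (Q i),
    forall i, (i < n)%N -> Q i `<=` Q i.+1 &
    forall i, (i < n)%N -> ~ (Q i.+1 `<=` Q i)].
Proof.
move=> sA fA dA.
have [P [qP mP]] : quasi_prime_chain_lengths A (star_tilde A star) n.
  apply: supremums_nat_mem dA; exists (fun=> set0); by split=> -[i i0]; have := i0; rewrite ltn0.
(* For [n = 0] there may be no quasi-prime to localize at; [V = K] serves, since [F K = K] contains
   every closure. *)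
case: n dA P qP mP => [|n] dA P qP mP.
  have sT : subring [set: K] by split.
  exists setT, (fun=> [set 0]); split=> //.
  - by split=> //; split=> // x _; left.
  - move=> F [[z Fz z0] _] x _; rewrite -(divfK z0 x) mulrC.
    exact: mul_set_one.
  - by move=> i _; apply: zero_prime.
pose f i : set K := if i is j.+1 then P (inord j) else [set 0].
pose p : set K := P ord_max.
have [[ip nzp ep] pp] := qP ord_max; rewrite -/p in ip nzp ep pp.
have A1 : A 1 by case: sA.
(* Otherwise each [M] misses an element of [p], which is invertible in [A_M], so 1 is in the closure
   of [p] and thus in [p]. An empty QMax is covered: the closure is then all of [K]. *)
have [M qM pM] : exists2 M, qmax A (star_f A star) M & p `<=` M.
  apply: contrapT => nM; apply: (prime_ideal1 pp); rewrite -/p -ep; split=> //.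
  move=> M qM; have [x px nMx] : exists2 x, p x & ~ M x.
    by apply: notsub_ex => h; apply: nM; exists M.
  have Ax := prime_ideal_sub pp px; have [_ [sM _]] := qmax1 qM.
  have x0 : x != 0 by apply/eqP => x0; apply: nMx; rewrite x0; exact: submod0 sM.
  by rewrite -(divff x0); apply: mul_set_one => //; exists 1, x; rewrite div1r.
have pf i : (i <= n.+1)%N -> prime_ideal A (f i).
  case: i => [_|i _]; first exact: zero_prime.
  by have [] := qP (inord i).
have mf i : (i < n.+1)%N -> f i `<` f i.+1.
  case: i => [_|i lti] /=.
    have [[_ [z Pz z0] _] pP0] := qP (inord 0).
    split; first by move=> _ ->; apply: prime_ideal0 pP0.
    by move=> /(_ z Pz) /= e; rewrite e eqxx in z0.
  by apply: mP; rewrite !inordK; lia.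
have fp i : (i <= n.+1)%N -> f i `<=` p.
  case: i => [_ _ ->|i]; first exact: prime_ideal0 pp.
  rewrite ltnS => /= lei; have [e|ne] := eqVneq (inord i : 'I_n.+1) ord_max.
    by rewrite e; exact: subset_refl.
  apply: properW; apply: mP; rewrite inordK //= ltn_neqAle lei andbT.
  by apply: contra ne => /eqP ->; apply/eqP/val_inj; rewrite /= inordK.
have sR := loc_subring sA pp; have AR := loc_sub sA pp.
set R := localization A p in sR AR.
have pg i : (i <= n.+1)%N -> prime_ideal R (ext_prime A p (f i)).
  by move=> ii; apply: ext_prime_prime => //; [apply: pf|apply: fp].
have [i ii|i ii h|V [Q [vV RV pQ QS nQ]]] :=
    @lift_prime_chain K R (fun i => ext_prime A p (f i)) n.+1 sR pg.
- by move=> x [a [s [fa As nps ->]]]; exists a, s; split=> //; case: (mf i ii) => h _; apply: h.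
- have [_] := mf i ii; apply=> x fx.
  have fA' := ext_primeI sA pp (pf _ (ltnW ii)) (fp _ (ltnW ii)).
  rewrite -fA'; split; first by apply: h; apply: ext_prime_in.
  exact: prime_ideal_sub (pf _ ii) fx.
exists V, Q; split=> //; first by split=> //; apply: subset_trans RV.
(* [V] is a star-valuation overring because [A_M <= A_p <= V]. *)
move=> F _; apply: (@subset_trans _ (mul_set F (localization A M))); first by move=> x; apply.
apply: mul_set_mono; apply: subset_trans RV; exact: loc_anti.
Qed.

Lemma star_dimvP A star n : subring A -> semistar A star ->
  (forall x, exists a s, [/\ A a, A s, s != 0 & x = a / s]) ->
  star_noetherian A (star_tilde A star) -> star_dim A (star_tilde A star) n ->
  star_dimv A (star_tilde A star) n.
Proof.
move=> sA sS fA nA dA.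
have ub V : star_valuation_overring A (star_tilde A star) V ->
    forall m (P : 'I_m.+1 -> set K), (forall i, prime_ideal V (P i)) ->
     (forall i j : 'I_m.+1, (i < j)%N -> P i `<` P j) -> (m <= n)%N.
  move=> [/valuation_overringP[vV AV] sV]; have [srV _] := vV.
  apply: krull_dim_le => // Q m.
  exact: (star_valuation_chain_le sA sS nA dA fA vV AV sV).
split=> [V hV|].
  have sV : subring V by case: hV => /valuation_overringP[[]].
  pose S m := exists P : 'I_m.+1 -> set K, (forall i, prime_ideal V (P i)) /\
    (forall i j : 'I_m.+1, (i < j)%N -> P i `<` P j).
  (* The dimension of [V] exists as the maximum of a bounded set of lengths, nonempty because of the
     zero ideal. *)
  have ex : exists m, `[< S m >].
    exists 0%N; apply/asboolP; exists (fun=> [set 0]); split; first by move=> _; apply: zero_prime.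
    by move=> i j; rewrite !ord1.
  have bd m : `[< S m >] -> (m <= n)%N by move=> /asboolP[P [pP mP]]; apply: ub pP mP.
  case: (ex_maxnP ex bd) => m /asboolP Sm mmax; exists m; last by apply: bd; apply/asboolP.
  split; first by move=> k Sk; apply: mmax; apply/asboolP.
  by move=> k; apply.
have [V [Q [hV stV pQ QS nQ]]] := star_valuation_of_dim sA fA dA.
have sV : star_valuation_overring A (star_tilde A star) V.
  by split=> //; apply/valuation_overringP.
exists V => //; split.
  by move=> k [P [pP mP]]; apply: ub pP mP.
move=> k; apply; exists (fun i : 'I_n.+1 => Q i); split.
  by move=> i; apply: pQ; rewrite -ltnS.
have mQ i j : (i <= j)%N -> (j <= n)%N -> Q i `<=` Q j.
  elim: j => [|j IH]; first by rewrite leqn0 => /eqP -> _; exact: subset_refl.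
  rewrite leq_eqVlt => /orP[/eqP -> _|]; first exact: subset_refl.
  by rewrite ltnS => ij jk; apply: subset_trans (IH ij (ltnW jk)) (QS _ jk).
move=> i j ij; have jn : (j <= n)%N by rewrite -ltnS.
split; first by apply: mQ => //; apply: ltnW.
move=> h; apply: (nQ i (leq_trans ij jn)).
by apply: subset_trans h; apply: mQ.
Qed.

End Semistar.

Lemma domain_in_frac_subring (D : idomainType) : subring (domain_in_frac D).
Proof.
split.
- by exists 1 => //; rewrite tofrac1.
- by move=> _ _ [a _ <-] [b _ <-]; exists (a - b) => //; rewrite tofracB.
- by move=> _ _ [a _ <-] [b _ <-]; exists (a * b) => //; rewrite tofracM.
Qed.

Lemma fracE (D : idomainType) (x : {fraction D}) : exists a s,
  [/\ domain_in_frac D a, domain_in_frac D s, s != 0 & x = a / s].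
Proof.
elim/quotW: x => r; exists (@FracField.tofrac D \n_r), (@FracField.tofrac D \d_r).
have d0 : \d_r != 0 by exact: denom_ratioP.
split; [by exists \n_r|by exists \d_r|by rewrite tofrac_eq0|].
apply: (canRL (mulfK _)); first by rewrite tofrac_eq0.
rewrite !piE.
apply/eqP; rewrite FracField.equivf_def /FracField.mulf /=.
rewrite !numden_Ratio ?mulr1 ?oner_eq0 ?mulf_neq0 ?oner_eq0 //.
by rewrite mulrC.
Qed.

Theorem corollary4p6 (D : idomainType)
    (star : set {fraction D} -> set {fraction D}) (n : nat) :
  semistar (domain_in_frac D) star ->
  star_noetherian (domain_in_frac D) (star_tilde (domain_in_frac D) star) ->
  star_dim (domain_in_frac D) (star_tilde (domain_in_frac D) star) n ->
  star_dimv (domain_in_frac D) (star_tilde (domain_in_frac D) star) n.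
Proof.
move=> sS nA dA; apply: star_dimvP => //; [exact: domain_in_frac_subring|exact: fracE].
Qed.
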